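(* Let $X$ be a reflexive Banach space with $1$-symmetric basis, let $d_0>1$, and let $\Omega$ be a bounded open subset of $\mathbb{R}^{d_0}$. Then for every separable closed subspace $Y$ of $JF_X^{*}(\Omega)$, the quotient $JF_X^{*}(\Omega)/Y$ is not reflexive.
   Context: Let $X$ be a (infinite-dimensional, real) reflexive Banach space with norm $\|\cdot\|_X$ and a $1$-symmetric basis $(e_n)_{n}$, i.e. $\|\sum_n \epsilon_n a_n e_{\pi(n)}\|_X=\|\sum_n a_n e_n\|_X$ for all finitely supported real $(a_n)$, all signs $\epsilon_n\in\{-1,1\}$ and all permutations $\pi$ of $\mathbb{N}$. For a (nonempty) bounded open set $\Omega\subset\mathbb{R}^{d_0}$, $\mathcal{P}(\Omega)$ denotes the set of all open parallelepipeds $T=\prod_{d=1}^{d_0}(\alpha_d,\beta_d)$, $\alpha_d<\beta_d$, with $T\subset\Omega$. With $\mu$ Lebesgue measure, $JF_X(\Omega)$ is the completion of $L^1(\Omega)$ under the norm $\|f\|_{JF_X(\Omega)}=\sup\{\|\sum_{j=1}^m(\int_{T_j}f\,d\mu)e_j\|_X : m\in\mathbb{N},\ T_1,\dots,T_m\in\mathcal{P}(\Omega)\text{ pairwise disjoint}\}$, and $JF_X^{*}(\Omega)$ is its dual. *)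

(* Defs.v *)
From HB Require Import structures.
From mathcomp Require Import all_boot all_order all_algebra.
From mathcomp Require Import all_classical all_reals all_analysis.
From mathcomp Require Import generic_quotient ring_quotient.
Import Order.TTheory GRing.Theory Num.Theory.
Import numFieldNormedType.Exports.

Set Implicit Arguments.
Unset Strict Implicit.
Unset Printing Implicit Defensive.

Local Open Scope classical_set_scope.
Local Open Scope ring_scope.
Local Open Scope quotient_scope.

Section lmod_quotient.
Variables (K : pzRingType) (V : lmodType K) (N : submodClosed V).

Fact submod_oppr_closed : oppr_closed N.
Proof. by have /GRing.submod_closedB/GRing.zmod_closedN := submodClosedP N. Qed.

Definition submod_zmod : zmodClosed V := HB.pack_for (zmodClosed V) (GRing.SubmodClosed.sort N)
  (GRing.isOppClosed.Build V (GRing.SubmodClosed.sort N) submod_oppr_closed).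

(* Library quotient of the group V by N, equipped below with the lmodType
   structure of V / N. *)
Definition lquot := Quotient.quot submod_zmod.
HB.instance Definition _ := Choice.on lquot.
HB.instance Definition _ := GRing.Zmodule.on lquot.
HB.instance Definition _ := EqQuotient.on lquot.
HB.instance Definition _ := ZmodQuotient.on lquot.

Lemma lquotBE (x y : V) : (x - y \in N) = (x == y %[mod lquot]).
Proof. exact: (@Quotient.idealrBE _ submod_zmod). Qed.

Definition quot_scale (a : K) : lquot -> lquot := lift_op1 lquot ( *:%R a).

Lemma pi_scale (a : K) : {morph \pi_lquot : x / a *: x >-> quot_scale a x}.
Proof.
move=> x; unlock quot_scale; apply/eqP.
by rewrite -lquotBE -scalerBr rpredZ // lquotBE reprK.
Qed.

Let scaleA a b (u : lquot) :
  quot_scale a (quot_scale b u) = quot_scale (a * b) u.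
Proof. by rewrite -[u]reprK -!pi_scale scalerA. Qed.

Let scale1 : left_id 1 quot_scale.
Proof. by move=> u; rewrite -[u]reprK -!pi_scale scale1r. Qed.

Let scaleDr : right_distributive quot_scale +%R.
Proof.
by move=> a u v; rewrite -[u]reprK -[v]reprK -raddfD -!pi_scale -raddfD scalerDr.
Qed.

Let scaleDl u : {morph quot_scale^~ u : a b / a + b}.
Proof. by move=> a b /=; rewrite -[u]reprK -!pi_scale -raddfD scalerDl. Qed.

HB.instance Definition _ :=
  GRing.Zmodule_isLmodule.Build K lquot scaleA scale1 scaleDr scaleDl.

Lemma pi_quotD (x y : V) : \pi_lquot (x + y) = \pi_lquot x + \pi_lquot y.
Proof. exact: raddfD. Qed.

Lemma pi_quot0 : \pi_lquot 0 = 0.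
Proof. exact: raddf0. Qed.

Lemma pi_quotZ (a : K) (x : V) : \pi_lquot (a *: x) = a *: \pi_lquot x.
Proof. exact: pi_scale. Qed.

Lemma repr_quot_sub (x : V) : repr (\pi_lquot x) - x \in N.
Proof. by rewrite lquotBE reprK. Qed.

End lmod_quotient.

Record seminorm (R : realType) (V : lmodType R) := Seminorm {
  seminorm_fun :> V -> R ;
  seminormD : forall x y, seminorm_fun (x + y) <= seminorm_fun x + seminorm_fun y ;
  seminormZ : forall a x, seminorm_fun (a *: x) = `|a| * seminorm_fun x }.

Section seminorm_theory.
Variables (R : realType) (V : lmodType R) (p : seminorm V).

Lemma seminorm0 : p 0 = 0.
Proof. by rewrite -(scale0r 0) seminormZ normr0 mul0r. Qed.

Lemma seminormN x : p (- x) = p x.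
Proof. by rewrite -scaleN1r seminormZ normrN1 mul1r. Qed.

Lemma seminorm_ge0 x : 0 <= p x.
Proof.
have := seminormD p x (- x); rewrite subrr seminorm0 seminormN.
by rewrite -mulr2n pmulrn_lge0.
Qed.

Lemma seminorm_dist x y : `|p x - p y| <= p (x - y).
Proof.
have h u v : p u <= p (u - v) + p v by rewrite -{1}(subrK v u) seminormD.
rewrite ler_norml; apply/andP; split; last by rewrite lerBlDr.
by rewrite lerNl opprB lerBlDr -(seminormN (x - y)) opprB.
Qed.

Lemma seminorm_eq x y : p (x - y) = 0 -> p x = p y.
Proof.
by move=> h; apply/eqP; rewrite -subr_eq0 -normr_le0 -h seminorm_dist.
Qed.

(* A seminorm descends to a norm on the quotient by its kernel. *)
Variable N : submodClosed V.
Hypothesis Np : forall x, x \in N <-> p x = 0.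
Local Notation Q := (lquot N).
Local Notation nm := (fun u : Q => p (repr u)).

Lemma seminorm_repr (x : V) : p (repr (\pi_Q x)) = p x.
Proof. exact/seminorm_eq/Np/repr_quot_sub. Qed.

Lemma quot_normD u v : nm (u + v) <= nm u + nm v.
Proof.
have -> : u + v = \pi_Q (repr u + repr v) by rewrite pi_quotD !reprK.
by rewrite seminorm_repr seminormD.
Qed.

Lemma quot_normZ a u : nm (a *: u) = `|a| * nm u.
Proof.
have -> : a *: u = \pi_Q (a *: repr u) by rewrite pi_quotZ reprK.
by rewrite seminorm_repr seminormZ.
Qed.

Lemma quot_norm_eq0 u : nm u = 0 -> u = 0.
Proof.
move=> /Np h; rewrite -(reprK u); apply/eqP.
by rewrite -(pi_quot0 N) -lquotBE subr0.
Qed.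

End seminorm_theory.

Section dual.
Variables (R : realType) (V : normedModType R).

Definition dual_pred : {pred V -> R} :=
  [pred f | `[< linear (f : V -> R^o) /\ continuous f >]].

Fact dual_submod_closed : submod_closed dual_pred.
Proof.
split.
  apply/asboolP; split; last by move=> x; exact: cst_continuous.
  by move=> a x y; rewrite /= scaler0 addr0.
move=> a f g /asboolP[lf cf] /asboolP[lg cg]; apply/asboolP; split.
  move=> b x y; rewrite /= !fctE lf lg !scalerDr.
  by rewrite !addrA; congr (_ + _); rewrite addrAC !scalerA mulrC.
by move=> x; apply: cvgD; [apply: cvgZr; exact: cf|exact: cg].
Qed.
HB.instance Definition _ :=
  GRing.isSubmodClosed.Build _ _ dual_pred dual_submod_closed.

Record dual := Dual { dual_fun :> V -> R ; dual_funP : dual_fun \in dual_pred }.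
HB.instance Definition _ := [isSub for dual_fun].
HB.instance Definition _ := [Choice of dual by <:].
HB.instance Definition _ := [SubChoice_isSubLmodule of dual by <:].

Lemma dual_linear (f : dual) : linear (f : V -> R^o).
Proof. by have /asboolP[] := dual_funP f. Qed.
HB.instance Definition _ (f : dual) :=
  GRing.isLinear.Build R V R^o _ (dual_fun f) (@dual_linear f).

Lemma dual_continuous (f : dual) : continuous f.
Proof. by have /asboolP[] := dual_funP f. Qed.

Definition dual_norm (f : dual) : R := sup [set `|f x| | x in [set x | `|x| <= 1]].

Lemma dual_has_sup (f : dual) : has_sup [set `|f x| | x in [set x | `|x| <= 1]].
Proof.
split; first by exists `|f 0|, 0 => //=; rewrite normr0.
have /linear_boundedP[M [_ fM]] : bounded_near (f : V -> R^o) (nbhs 0).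
  exact/linear_bounded_continuous/dual_continuous.
exists (`|M| + 1) => _ [x x1 <-].
have := fM (`|M| + 1); rewrite (le_lt_trans (ler_norm M)) ?ltrDl// => /(_ isT x).
by move=> /le_trans; apply; rewrite ler_piMr.
Qed.

Lemma dual_norm_ub (f : dual) x : `|x| <= 1 -> `|f x| <= dual_norm f.
Proof. by move=> x1; apply: sup_upper_bound; [exact: dual_has_sup|exists x]. Qed.

Lemma dual_norm_ge0 f : 0 <= dual_norm f.
Proof. by apply: le_trans (dual_norm_ub f (x := 0) _); rewrite ?normr0. Qed.

Lemma dual_norm_le (f : dual) c :
  (forall x, `|x| <= 1 -> `|f x| <= c) -> dual_norm f <= c.
Proof.
move=> fc; apply: ge_sup; first by case: (dual_has_sup f).
by move=> _ [x x1 <-]; exact: fc.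
Qed.

Lemma dual_normD f g : dual_norm (f + g) <= dual_norm f + dual_norm g.
Proof.
apply: dual_norm_le => x x1; apply: le_trans (ler_normD _ _) _.
by apply: lerD; exact: dual_norm_ub.
Qed.

Lemma dual_normZ a f : dual_norm (a *: f) = `|a| * dual_norm f.
Proof.
have le_ b g : dual_norm (b *: g) <= `|b| * dual_norm g.
  apply: dual_norm_le => x x1.
  have -> : (b *: g) x = b * g x by [].
  by rewrite normrM ler_wpM2l// dual_norm_ub.
apply/eqP; rewrite eq_le le_ /=.
have [->|a0] := eqVneq a 0; first by rewrite normr0 mul0r dual_norm_ge0.
rewrite -ler_pdivlMl ?normr_gt0// -normfV.
by apply: le_trans (le_ _ _); rewrite scalerA mulVf// scale1r.
Qed.

Lemma dual_norm_eq0 f : dual_norm f = 0 -> f = 0.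
Proof.
move=> f0; apply/val_inj/funext => x /=.
have fu y : `|y| <= 1 -> f y = 0.
  by move=> /(dual_norm_ub f); rewrite f0 normr_le0 => /eqP.
have [->|x0] := eqVneq x 0; first by rewrite linear0.
have xn : `|x| != 0 by rewrite normr_eq0.
have : f (`|x|^-1 *: x) = 0 by apply: fu; rewrite normrZ normfV normr_id mulVf.
by rewrite linearZ/= => /eqP; rewrite mulf_eq0 invr_eq0 (negbTE xn) => /eqP.
Qed.

HB.instance Definition _ :=
  Lmodule_isNormed.Build R dual dual_normD dual_normZ dual_norm_eq0.

End dual.

(* Surjectivity of the canonical embedding x |-> (f |-> f x) into the bidual. *)
Definition reflexive_space (R : realType) (V : normedModType R) :=
  forall F : dual (dual V), exists x : V, forall f : dual V, F f = f x.

Record closed_subspace (R : realType) (V : normedModType R) := ClosedSubspace {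
  subspace_pred :> submodClosed V ;
  subspace_closed : closed [set` subspace_pred] }.

Section quotient_space.
Variables (R : realType) (V : normedModType R) (Y : closed_subspace V).

Let dset x := [set `|x - y| | y in [set` Y]].
Let dist x := inf (dset x).

Let dset_inf x : has_inf (dset x).
Proof.
split; first by exists `|x - 0|, 0 => //=; exact: rpred0.
by exists 0 => _ [y _ <-].
Qed.

Let dist_le x y : y \in Y -> dist x <= `|x - y|.
Proof. by move=> yY; apply: ge_inf; [case: (dset_inf x)|exists y]. Qed.

Let dist_ge x c : (forall y, y \in Y -> c <= `|x - y|) -> c <= dist x.
Proof.
move=> h; apply: lb_le_inf; first by case: (dset_inf x).
by move=> _ [y yY <-]; exact: h.
Qed.

Let dist_ge0 x : 0 <= dist x. Proof. exact: dist_ge. Qed.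

Let distD x y : dist (x + y) <= dist x + dist y.
Proof.
rewrite -lerBlDr; apply: dist_ge => a aY; rewrite lerBlDr -lerBlDl.
apply: dist_ge => b bY; rewrite lerBlDl.
apply: le_trans (dist_le _ (rpredD aY bY)) _.
by rewrite opprD addrACA ler_normD.
Qed.

Let distZ a x : dist (a *: x) = `|a| * dist x.
Proof.
have dist0 : dist 0 = 0.
  apply/eqP; rewrite eq_le dist_ge0 andbT.
  by apply: le_trans (dist_le _ (rpred0 Y)) _; rewrite subr0 normr0.
have [->|a0] := eqVneq a 0; first by rewrite scale0r normr0 mul0r.
have le_ b z : b != 0 -> dist (b *: z) <= `|b| * dist z.
  move=> b0; rewrite -ler_pdivrMl ?normr_gt0//; apply: dist_ge => y yY.
  rewrite ler_pdivrMl ?normr_gt0// -normrZ scalerBr.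
  by apply: dist_le; exact: rpredZ.
apply/eqP; rewrite eq_le le_//= -ler_pdivlMl ?normr_gt0// -normfV.
by apply: le_trans (le_ _ _ _); rewrite ?invr_eq0// scalerA mulVf// scale1r.
Qed.

Let p := Seminorm distD distZ.

Let dist_eq0 x : x \in (Y : submodClosed V) <-> p x = 0.
Proof.
split=> [xY|x0].
  apply/eqP; rewrite eq_le [X in _ && X]dist_ge0 andbT.
  by apply: le_trans (dist_le _ xY) _; rewrite subrr normr0.
apply: (subspace_closed (c := Y)) => B /nbhs_ballP[e /= e0 xB].
have : inf (dset x) < e by rewrite [inf _]x0.
move=> /(inf_lt (proj1 (dset_inf x)))[_ [y yY <-] xye].
by exists y; split => //; apply: xB; rewrite -ball_normE.
Qed.

Definition quotient_space := lquot Y.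
HB.instance Definition _ := Choice.on quotient_space.
HB.instance Definition _ := GRing.Lmodule.on quotient_space.
HB.instance Definition _ := EqQuotient.on quotient_space.
HB.instance Definition _ := ZmodQuotient.on quotient_space.

(* Infimum of the norms of the representatives of the coset. *)
Definition quotient_norm (u : quotient_space) : R :=
  inf [set `|x| | x in [set x : V | \pi_quotient_space x = u]].

Let quotient_normE u : quotient_norm u = p (repr (u : lquot Y)).
Proof.
congr inf; apply/seteqP; split=> [_ [x /= xu <-]|_ [y /= yY <-]].
  exists (repr (u : lquot Y) - x); last by rewrite opprB addrC subrK.
  by rewrite /= -xu; exact: repr_quot_sub.
exists (repr (u : lquot Y) - y) => //=.
rewrite -[RHS]reprK; apply/eqP; rewrite -[_ == _]lquotBE.
by rewrite addrAC subrr sub0r; exact: submod_oppr_closed.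
Qed.

Let quotient_normD u v :
  quotient_norm (u + v) <= quotient_norm u + quotient_norm v.
Proof. by rewrite !quotient_normE; exact: (quot_normD dist_eq0). Qed.

Let quotient_normZ a u : quotient_norm (a *: u) = `|a| * quotient_norm u.
Proof. by rewrite !quotient_normE; exact: (quot_normZ dist_eq0). Qed.

Let quotient_norm_eq0 u : quotient_norm u = 0 -> u = 0.
Proof. by rewrite quotient_normE; exact: (quot_norm_eq0 dist_eq0). Qed.

HB.instance Definition _ := Lmodule_isNormed.Build R quotient_space
  quotient_normD quotient_normZ quotient_norm_eq0.

End quotient_space.

Definition separable_set (T : topologicalType) (A : set T) :=
  exists D : set T, [/\ countable D, D `<=` A & A `<=` closure D].

(* Hausdorff completion of a seminormed space: Cauchy sequences modulo null
   sequences, with the limit of p as norm. When p is a norm this is the usual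
   completion. *)
Section completion.
Variables (R : realType) (V : lmodType R) (p : seminorm V).

Definition cauchy_pred : {pred nat -> V} := [pred u | `[<
  forall e : R, 0 < e ->
  exists N, forall m n, (N <= m)%N -> (N <= n)%N -> p (u m - u n) < e >]].

Fact cauchy_submod_closed : submod_closed cauchy_pred.
Proof.
split.
  apply/asboolP => e e0; exists 0%N => m n _ _.
  by rewrite subrr seminorm0.
move=> a u v /asboolP cu /asboolP cv; apply/asboolP => e e0.
have a1 : 0 < `|a| + 1 by rewrite ltr_wpDl.
have [M uM] := cu (e / 2 / (`|a| + 1)) ltac:(by rewrite !divr_gt0).
have [N vN] := cv (e / 2) ltac:(by rewrite divr_gt0).
exists (maxn M N) => m n; rewrite !geq_max => /andP[Mm Nm] /andP[Mn Nn].
rewrite [X in p X](_ : _ = a *: (u m - u n) + (v m - v n)); last first.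
  by rewrite !fctE scalerBr opprD addrACA.
apply: le_lt_trans (seminormD _ _ _) _; rewrite seminormZ (splitr e).
apply: ler_ltD; last exact: vN.
have := uM m n Mm Mn; rewrite ltr_pdivlMr// => /ltW; apply: le_trans.
by rewrite mulrC ler_wpM2l ?seminorm_ge0// lerDl.
Qed.
HB.instance Definition _ :=
  GRing.isSubmodClosed.Build _ _ cauchy_pred cauchy_submod_closed.

Record cauchy_seq := CauchySeq {
  cauchy_fun :> nat -> V ; cauchy_funP : cauchy_fun \in cauchy_pred }.
HB.instance Definition _ := [isSub for cauchy_fun].
HB.instance Definition _ := [Choice of cauchy_seq by <:].
HB.instance Definition _ := [SubChoice_isSubLmodule of cauchy_seq by <:].

Definition cauchy_norm (u : cauchy_seq) : R := limn (fun n => p (u n)).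

Lemma cauchy_norm_cvg (u : cauchy_seq) : cvgn (fun n => p (u n)).
Proof.
have /asboolP cu := cauchy_funP u.
apply/cauchy_cvgP/cauchyP => e e0; have [N uN] := cu e e0.
exists (p (u N)); exists N => // n /= Nn.
exact: le_lt_trans (seminorm_dist _ _ _) (uN _ _ _ _).
Qed.

Lemma cauchy_normD u v : cauchy_norm (u + v) <= cauchy_norm u + cauchy_norm v.
Proof.
rewrite /cauchy_norm -limD; [|exact: cauchy_norm_cvg..].
apply: ler_lim; [exact: cauchy_norm_cvg| |].
  by apply: is_cvgD; exact: cauchy_norm_cvg.
by apply: nearW => n; exact: seminormD.
Qed.

Lemma cauchy_normZ a u : cauchy_norm (a *: u) = `|a| * cauchy_norm u.
Proof.
rewrite /cauchy_norm -[RHS]limZr; last exact: cauchy_norm_cvg.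
by congr (limn _); apply/funext => n; exact: seminormZ.
Qed.

Definition cauchy_seminorm := Seminorm cauchy_normD cauchy_normZ.

Definition null_seq : {pred cauchy_seq} :=
  [pred u : cauchy_seq | `[< p (u n) @[n --> \oo] --> 0 >]].

Lemma null_seqP (u : cauchy_seq) : u \in null_seq <-> cauchy_seminorm u = 0.
Proof.
split=> [/asboolP h|u0]; first exact: cvg_lim.
by apply/asboolP; rewrite -u0; exact: cauchy_norm_cvg.
Qed.

Fact null_seq_submod_closed : submod_closed null_seq.
Proof.
split; first by apply/null_seqP; exact: seminorm0.
move=> a u v /null_seqP u0 /null_seqP v0; apply/null_seqP/eqP.
rewrite eq_le seminorm_ge0 andbT (le_trans (seminormD _ _ _))//.
by rewrite seminormZ u0 v0 mulr0 addr0.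
Qed.
HB.instance Definition _ :=
  GRing.isSubmodClosed.Build _ _ null_seq null_seq_submod_closed.

Definition completion := lquot null_seq.
HB.instance Definition _ := Choice.on completion.
HB.instance Definition _ := GRing.Lmodule.on completion.
HB.instance Definition _ := EqQuotient.on completion.
HB.instance Definition _ := ZmodQuotient.on completion.

Definition completion_norm (u : completion) : R :=
  limn (fun n => p (repr u n)).

Let completion_normD u v :
  completion_norm (u + v) <= completion_norm u + completion_norm v.
Proof. exact: (quot_normD null_seqP). Qed.

Let completion_normZ a u : completion_norm (a *: u) = `|a| * completion_norm u.
Proof. exact: (quot_normZ null_seqP). Qed.

Let completion_norm_eq0 u : completion_norm u = 0 -> u = 0.
Proof. exact: (quot_norm_eq0 null_seqP). Qed.

HB.instance Definition _ := Lmodule_isNormed.Build R completion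
  completion_normD completion_normZ completion_norm_eq0.

End completion.

(* R^n is 'rV[R]_n with its product topology and its Borel sigma-algebra. *)
Section borel_rV.
Variables (R : realType) (n : nat).

Let borel0 : <<s @open 'rV[R]_n >> set0. Proof. exact: sigma_algebra0. Qed.
Let borelC A : <<s @open 'rV[R]_n >> A -> <<s @open 'rV[R]_n >> (~` A).
Proof. exact: sigma_algebraC. Qed.
Let borel_bigcup (F : (set 'rV[R]_n)^nat) :
  (forall i, <<s @open 'rV[R]_n >> (F i)) ->
  <<s @open 'rV[R]_n >> (\bigcup_i F i).
Proof. exact: sigma_algebra_bigcup. Qed.

HB.instance Definition _ := @isMeasurable.Build default_measure_display
  'rV[R]_n <<s @open 'rV[R]_n >> borel0 borelC borel_bigcup.

Lemma measurable_rVE : @measurable _ 'rV[R]_n = <<s @open 'rV[R]_n >>.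
Proof. by []. Qed.

Lemma open_measurable_rV (A : set 'rV[R]_n) : open A -> measurable A.
Proof. exact: sub_sigma_algebra. Qed.

End borel_rV.

Section lebesgue_rV.
Variable R : realType.

Definition rat_ball n (c : 'rV[rat]_n * rat) : set 'rV[R]_n :=
  ball (\row_j ratr (c.1 0 j) : 'rV[R]_n) (ratr c.2).

Lemma open_rat_balls n (A : set 'rV[R]_n) : open A ->
  A = \bigcup_(c in [set c | rat_ball c `<=` A]) rat_ball c.
Proof.
move=> oA; apply/seteqP; split=> [x Ax|x [c cA]]; last exact: cA.
have /nbhs_ballP[e /= e0 xA] : nbhs x A by exact: open_nbhs_nbhs.
have [q] : exists q : rat, ratr q \in `]0, (e / 2)[.
  by apply: rat_in_itvoo; rewrite divr_gt0.
rewrite in_itv/= => /andP[q0 qe].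
have /choice[c xc] : forall i, exists c : rat, ball (x 0 i) (ratr q) (ratr c).
  move=> i; have [c] := @rat_in_itvoo R (x 0 i - ratr q) (x 0 i + ratr q)
    ltac:(by rewrite ltrBlDr -addrA ltrDl addr_gt0).
  by move=> cx; exists c; rewrite ball_itv.
have xcq : ball x (ratr q) (\row_j ratr ((\row_i c i) 0 j) : 'rV[R]_n).
  by split=> // i j; rewrite !mxE ord1; exact: xc.
exists (\row_i c i, q) => /=; last exact: ball_sym.
move=> y cy; apply: xA; rewrite (splitr e).
by apply: ball_triangle; [exact: le_ball (ltW qe) _ xcq|exact: le_ball (ltW qe) _ cy].
Qed.

Definition row_cons n (p : measurableTypeR R * 'rV[R]_n) : 'rV[R]_n.+1 :=
  \row_i oapp (p.2 0) p.1 (unlift ord0 i).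

Lemma row_consE0 n p : @row_cons n p 0 ord0 = p.1.
Proof. by rewrite mxE unlift_none. Qed.

Lemma row_consES n p i : @row_cons n p 0 (lift ord0 i) = p.2 0 i.
Proof. by rewrite mxE liftK. Qed.

Lemma row_cons_measurable n : measurable_fun setT (@row_cons n).
Proof.
apply: (measurability _ (@measurable_rVE _ _)) => // _ [A oA <-].
rewrite setTI (open_rat_balls oA) preimage_bigcup.
rewrite bigcup_mkcond; apply: countable_bigcupT_measurable => // -[c q] /=.
case: ifPn => // _; rewrite /rat_ball/=.
have [q0|q0] := ltP 0 (ratr q : R); last first.
  rewrite (_ : _ @^-1` _ = set0)//; apply/seteqP; split=> // p [].
  by rewrite ltNge q0.
rewrite (_ : _ @^-1` _ =
   ball (ratr (c 0 ord0) : R) (ratr q) `*`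
   ball (\row_j ratr (c 0 (lift ord0 j)) : 'rV[R]_n) (ratr q)).
  apply: measurableX; first by apply: measurable_realfun.open_measurable; exact: ball_open.
  by apply: open_measurable_rV; exact: ball_open.
apply/seteqP; split=> p /=.
  move=> [_ cp]; split=> /=; first by have := cp 0 ord0; rewrite row_consE0 mxE.
  split=> // i j; have := cp i (lift ord0 j).
  by rewrite ord1 row_consES !mxE.
move=> [p1 [_ p2]]; split=> // i j; rewrite ord1.
have [k ->|->] := unliftP ord0 j; last by rewrite row_consE0 mxE.
by have := p2 0 k; rewrite row_consES !mxE.
Qed.

Section step.
Variables (n : nat) (mu : {sigma_finite_measure set 'rV[R]_n -> \bar R}).

(* Image of the product measure under R x R^n -> R^n.+1. *)
Definition lebesgue_step : set 'rV[R]_n.+1 -> \bar R :=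
  pushforward (lebesgue_measure \x mu)%E (@row_cons n).

HB.instance Definition _ := Measure.copy lebesgue_step
  (measure_function_pushforward__canonical__measure_function_Measure
     (lebesgue_measure \x mu)%E (@row_cons_measurable n)).

Let lebesgue_step_sigma_finite : sigma_finite setT lebesgue_step.
Proof.
have [F FT Foo] : sigma_finite setT (lebesgue_measure \x mu)%E.
  have /sigma_finiteP[G [GT ndG Goo]] := sigma_finiteT (@lebesgue_measure R).
  have /sigma_finiteP[H [HT ndH Hoo]] := sigma_finiteT mu.
  exists (fun k => G k `*` H k) => [|k].
    rewrite -setXTT GT HT; apply/seteqP; split=> -[x y] /=.
      move=> [[i _ Gx] [j _ Hy]]; exists (maxn i j) => //; split.
        by move: x Gx; apply/subsetPset/ndG/leq_maxl.
      by move: y Hy; apply/subsetPset/ndH/leq_maxr.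
    by move=> [k _ [Gx Hy]]; split; exists k.
  have [mG Gk] := Goo k; have [mH Hk] := Hoo k; split; first exact: measurableX.
  by rewrite product_measure1E// lte_mul_pinfty// ge0_fin_numE.
pose h (x : 'rV[R]_n.+1) : measurableTypeR R * 'rV[R]_n :=
  (x 0 ord0, \row_j x 0 (lift ord0 j)).
have hK : cancel (@row_cons n) h.
  move=> [a v]; rewrite /h row_consE0; congr pair.
  by apply/rowP => j; rewrite mxE row_consES.
have Kh : cancel h (@row_cons n).
  move=> x; apply/rowP => j.
  have [k ->|->] := unliftP ord0 j; first by rewrite row_consES mxE.
  by rewrite row_consE0.
have mh : measurable_fun setT h.
  apply/measurable_fun_pairP; split => /=.
    apply: (measurability _ (measurable_realfun.RGenOpens.measurableE R)) => // _ [_ [a [b ->]] <-].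
    rewrite setTI; apply: open_measurable_rV; apply: open_comp; last exact: interval_open.
    by move=> x _; exact: coord_continuous.
  apply: (measurability _ (@measurable_rVE _ _)) => // _ [A oA <-].
  rewrite setTI; apply: open_measurable_rV; rewrite openE => x /= Ax.
  have /nbhs_ballP[e /= e0 eA] : nbhs (\row_j x 0 (lift ord0 j) : 'rV[R]_n) A.
    exact: open_nbhs_nbhs.
  apply/nbhs_ballP; exists e => // y [_ xy]; apply: eA; split=> // i j.
  by rewrite !mxE; exact: xy.
exists (fun i => h @^-1` F i) => [|i].
  by rewrite -preimage_bigcup -FT preimage_setT.
have [mF Fi] := Foo i; split.
  by rewrite -[X in measurable X]setTI; exact: mh.
by rewrite /lebesgue_step /pushforward -comp_preimage (_ : h \o _ = id)//; exact/funext.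
Qed.

HB.instance Definition _ :=
  @Measure_isSigmaFinite.Build _ _ _ lebesgue_step lebesgue_step_sigma_finite.

End step.

Fixpoint lebesgue_rV n : {sigma_finite_measure set 'rV[R]_n -> \bar R} :=
  if n is n'.+1 then lebesgue_step (lebesgue_rV n')
  else dirac (0 : 'rV[R]_0).

End lebesgue_rV.

(* 1-symmetric Schauder basis; the signs are (-1) ^+ eps n, and finitely supported
   scalar sequences are truncations to n < N. The vectors are not assumed to be
   normalized. *)
Record symmetric_basis (R : realType) (X : normedModType R) := SymmetricBasis {
  basis_fun :> nat -> X ;
  basis_schauder : forall x : X,
    exists! a : nat -> R, series (fun n => a n *: basis_fun n) @ \oo --> x ;
  basis_symmetric : forall (N : nat) (a : nat -> R) (eps : nat -> bool)
      (s : nat -> nat), bijective s ->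
    `|\sum_(n < N) ((-1) ^+ eps n * a n) *: basis_fun (s n)| =
    `|\sum_(n < N) a n *: basis_fun n| }.

Lemma basis_norm (R : realType) (X : normedModType R) (e : symmetric_basis X) n :
  `|e n| = `|e 0%N|.
Proof.
pose s k := if k == 0%N then n else if k == n then 0%N else k.
have ss : involutive s.
  rewrite /s => k; have [->|k0] := eqVneq k 0%N.
    by have [->|_] := eqVneq n 0%N; rewrite ?eqxx.
  have [->|kn] := eqVneq k n; first by rewrite eqxx.
  by rewrite (negbTE k0) (negbTE kn).
have := basis_symmetric e 1 (fun=> 1) (fun=> false) (Bijective ss ss).
by rewrite !big_ord1 expr0 mul1r !scale1r /s eqxx.
Qed.

Section JF.
Variables (R : realType) (d : nat) (Omega : set 'rV[R]_d).
Local Notation mu := (lebesgue_rV R d).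

Definition parallelepipeds : set (set 'rV[R]_d) :=
  [set T | exists a b : 'rV[R]_d, [/\ forall i, a 0 i < b 0 i,
     T = [set x : 'rV[R]_d | forall i, a 0 i < x 0 i < b 0 i] & T `<=` Omega]].

Lemma parallelepiped_measurable T : parallelepipeds T -> measurable T.
Proof.
move=> [a [b [_ -> _]]].
rewrite (_ : [set _ | _] = \bigcap_(i in [set: 'I_d])
    ((fun x : 'rV[R]_d => x 0 i) @^-1` `]a 0 i, b 0 i[)); last first.
  by apply/seteqP; split=> x /= h i; [move=> _|]; have := h i; rewrite /= in_itv//=; apply.
apply: fin_bigcap_measurable => // i _; apply: open_measurable_rV.
apply: open_comp; last exact: interval_open.
by move=> x _; exact: coord_continuous.
Qed.

Hypothesis oOmega : open Omega.

Definition integrable_pred of open Omega : {pred 'rV[R]_d -> R} :=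
  [pred f | `[< mu.-integrable Omega (EFin \o f) >]].

Let mOmega : measurable Omega := open_measurable_rV oOmega.

Fact integrable_submod_closed : submod_closed (integrable_pred oOmega).
Proof.
split; first by apply/asboolP; exact: integrable0.
move=> a f g /asboolP fi /asboolP gi; apply/asboolP.
rewrite (_ : _ \o _ = (fun x => a%:E * (f x)%:E) \+ (EFin \o g))%E//.
by apply: integrableD => //; exact: (integrableZl _ _ fi).
Qed.
HB.instance Definition _ :=
  GRing.isSubmodClosed.Build _ _ (integrable_pred oOmega) integrable_submod_closed.

Record integrable_fun := IntegrableFun {
  integrable_val :> 'rV[R]_d -> R ;
  integrable_valP : integrable_val \in integrable_pred oOmega }.
HB.instance Definition _ := [isSub for integrable_val].
HB.instance Definition _ := [Choice of integrable_fun by <:].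
HB.instance Definition _ := [SubChoice_isSubLmodule of integrable_fun by <:].

Lemma integrable_funP (f : integrable_fun) : mu.-integrable Omega (EFin \o f).
Proof. by have /asboolP := integrable_valP f. Qed.

Definition ae_zero : {pred integrable_fun} :=
  [pred f : integrable_fun | `[< {ae mu, forall x, Omega x -> f x = 0} >]].

Fact ae_zero_submod_closed : submod_closed ae_zero.
Proof.
split; first by apply/asboolP; exact: aeW.
move=> a f g /asboolP f0 /asboolP g0; apply/asboolP.
apply: filterS2 f0 g0 => x f0 g0 Ox /=.
rewrite [LHS](_ : _ = a * f x + g x); last by [].
by rewrite f0// g0// mulr0 addr0.
Qed.
HB.instance Definition _ :=
  GRing.isSubmodClosed.Build _ _ ae_zero ae_zero_submod_closed.

(* Functions need only be Borel on Omega; identifying functions that agree almost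
   everywhere on Omega gives the same space as Lebesgue measurable functions. *)
Definition L1 := lquot ae_zero.
HB.instance Definition _ := Choice.on L1.
HB.instance Definition _ := GRing.Lmodule.on L1.
HB.instance Definition _ := EqQuotient.on L1.
HB.instance Definition _ := ZmodQuotient.on L1.

(* For T a parallelepiped in Omega this does not depend on the representative, see
   L1_integral_pi. *)
Definition L1_integral (T : set 'rV[R]_d) (f : L1) : R :=
  \int[mu]_(x in T) (repr f : integrable_fun) x.

Section parallelepiped_integral.
Variables (T : set 'rV[R]_d) (PT : parallelepipeds T).
Let mT := parallelepiped_measurable PT.

Lemma parallelepiped_integrable (f : integrable_fun) :
  mu.-integrable T (EFin \o f).
Proof.
case: (PT) => a [b [_ _ TO]].
exact: integrableS TO (integrable_funP f).
Qed.

Lemma L1_integral_pi (f : integrable_fun) :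
  L1_integral T (\pi f) = \int[mu]_(x in T) f x.
Proof.
congr fine; apply: ae_eq_integral => //.
- by have /integrableP[] := parallelepiped_integrable (repr (\pi_L1 f)).
- by have /integrableP[] := parallelepiped_integrable f.
have /asboolP := repr_quot_sub ae_zero f.
apply: filterS => x h Tx; case: (PT) => a [b [_ _ /(_ x Tx)/h]].
by move=> /eqP; rewrite subr_eq0 => /eqP /= ->.
Qed.

Lemma L1_integralD f g :
  L1_integral T (f + g) = L1_integral T f + L1_integral T g.
Proof.
rewrite -[f]reprK -[g]reprK -pi_quotD !L1_integral_pi.
by rewrite RintegralD//; exact: parallelepiped_integrable.
Qed.

Lemma L1_integralZ a f : L1_integral T (a *: f) = a * L1_integral T f.
Proof.
rewrite -[f]reprK -pi_quotZ !L1_integral_pi.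
by rewrite RintegralZl//; exact: parallelepiped_integrable.
Qed.

End parallelepiped_integral.

Variables (X : normedModType R) (e : symmetric_basis X).

Definition JF_sums (f : L1) : set R :=
  [set r | exists (m : nat) (T : 'I_m -> set 'rV[R]_d),
     [/\ forall j, parallelepipeds (T j), trivIset setT T &
         r = `|\sum_(j < m) L1_integral (T j) f *: e j|]].

(* The supremum is finite, see JF_sums_has_sup. *)
Definition JF_norm (f : L1) : R := sup (JF_sums f).

Lemma JF_sums_has_sup f : has_sup (JF_sums f).
Proof.
split.
  exists 0, 0%N, (fun=> set0); split; [by case|by move=> []|].
  by rewrite big_ord0 normr0.
exists (\int[mu]_(x in Omega) `|(repr f : integrable_fun) x| * `|e 0%N|).
move=> _ [m [T [PT TT ->]]].
apply: le_trans (ler_norm_sum _ _ _) _.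
under eq_bigr do rewrite normrZ basis_norm.
rewrite -mulr_suml ler_wpM2r//.
have mT j := parallelepiped_measurable (PT j).
apply: (@le_trans _ _ (\sum_(j < m) \int[mu]_(x in T j) `|(repr f : integrable_fun) x|)).
  by apply: ler_sum => j _; apply: le_normr_Rintegral => //; exact: parallelepiped_integrable.
set h := (repr f : integrable_fun) : 'rV[R]_d -> R.
have hO : mu.-integrable Omega (EFin \o (Num.norm \o h)).
  exact: integrable_norm (integrable_funP _).
have hT j : mu.-integrable (T j) (EFin \o (Num.norm \o h)).
  exact: integrable_norm (parallelepiped_integrable (PT j) _).
have TO : \big[setU/set0]_(j < m) T j `<=` Omega.
  rewrite -bigcup_seq => x [j _ Tjx]; have [a [b [_ _]]] := PT j; exact.
have mhO := measurable_int _ hO.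
rewrite -lee_fin -sumEFin /Rintegral fineK; last exact: integrable_fin_num hO.
rewrite (eq_bigr (fun j => \int[mu]_(x in T j) (`|h x|)%:E)%E); last first.
  by move=> j _; rewrite fineK//; exact: integrable_fin_num (hT j).
rewrite -ge0_integral_bigsetU//=.
- apply: ge0_subset_integral => //.
  by apply: bigsetU_measurable.
- by rewrite index_enum_uniq.
- exact: sub_trivIset TT.
- by apply: measurable_funS mhO.
Qed.

Lemma JF_normD f g : JF_norm (f + g) <= JF_norm f + JF_norm g.
Proof.
apply: ge_sup; first by case: (JF_sums_has_sup (f + g)).
move=> _ [m [T [PT TT ->]]].
under eq_bigr do rewrite L1_integralD// scalerDl.
rewrite big_split; apply: le_trans (ler_normD _ _) _.
by apply: lerD; (apply: sup_upper_bound; first exact: JF_sums_has_sup);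
  exists m, T.
Qed.

Lemma JF_normZ a f : JF_norm (a *: f) = `|a| * JF_norm f.
Proof.
have le_ b g : JF_norm (b *: g) <= `|b| * JF_norm g.
  apply: ge_sup; first by case: (JF_sums_has_sup (b *: g)).
  move=> _ [m [T [PT TT ->]]].
  under eq_bigr do rewrite L1_integralZ// -scalerA.
  rewrite -scaler_sumr normrZ ler_wpM2l//.
  by apply: sup_upper_bound; [exact: JF_sums_has_sup|exists m, T].
have ge0 g : 0 <= JF_norm g.
  apply: sup_upper_bound; first exact: JF_sums_has_sup.
  exists 0%N, (fun=> set0); split; [by case|by move=> []|].
  by rewrite big_ord0 normr0.
apply/eqP; rewrite eq_le le_ /=.
have [->|a0] := eqVneq a 0; first by rewrite normr0 mul0r ge0.
rewrite -ler_pdivlMl ?normr_gt0// -normfV.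
by apply: le_trans (le_ _ _); rewrite scalerA mulVf// scale1r.
Qed.

Definition JF_seminorm : seminorm L1 := Seminorm JF_normD JF_normZ.

Definition JF := completion JF_seminorm.
HB.instance Definition _ := NormedModule.on JF.

End JF.

(* Main.v *)
Require Import Defs.
From HB Require Import structures.
From mathcomp Require Import all_boot all_order all_algebra perm.
From mathcomp Require Import all_classical all_reals all_analysis.
From mathcomp Require Import ring lra.
Import Order.TTheory GRing.Theory Num.Theory.
Import numFieldNormedType.Exports.

Set Implicit Arguments.
Unset Strict Implicit.
Unset Printing Implicit Defensive.

Local Open Scope classical_set_scope.
Local Open Scope ring_scope.

(* A space is not reflexive as soon as it carries bounded vectors w_n and bounded
   functionals g_k with g_k(w_n) = 1 for k <= n and 0 otherwise. In JF*/Y the w_n are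
   the integrals over growing boxes ]t, t + h[ x ]s_0, s_(n+1)[ x ..., and g_k is the
   jump at {t} x K_k, with K_k = ]s_k, s_(k+1)[ x ...: the limit as eps -> 0 of the mean
   over ]t, t + eps[ x K_k minus the mean over ]t - eps, t[ x K_k. It remains to choose t
   so that these jumps vanish on Y. For fixed k, a box sees the jump at t only if one of
   its two faces orthogonal to the first axis is near t, so the sum of N jumps at distinct
   points t_i has norm O(F(m) (1 + N / m)) for every m, where F(m) = |e_0 + ... + e_(m-1)|.
   Reflexivity of X forces inf F(m) / m = 0, since otherwise e would be equivalent to the
   l^1 basis; hence each functional on JF has only countably many t with a nonzero jump,
   and all t but countably many are good for a separable Y. *)

(** * Generalized limits of bounded real sequences *)

Definition bounded_seq (R : realType) (u : nat -> R) :=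
  exists M : R, forall n, `|u n| <= M.

(** Models the limit along an ultrafilter refining the neighbourhoods of infinity; shift invariance
    is not among the properties. *)
Record banach_limit (R : realType) (L : (nat -> R) -> R) : Prop := BanachLimit {
  banach_limit_linear : forall a u v, bounded_seq u -> bounded_seq v ->
    L (fun n => a * u n + v n) = a * L u + L v ;
  banach_limit_le : forall u c, bounded_seq u ->
    (\forall n \near \oo, u n <= c) -> L u <= c ;
  banach_limit_eq : forall u c, (\forall n \near \oo, u n = c) -> L u = c ;
  banach_limit_norm : forall u c, (forall n, `|u n| <= c) -> `|L u| <= c }.

(** Take the limit along an ultrafilter finer than [\oo]: the image of the ultrafilter under a
    bounded sequence lives in a compact segment, hence converges. *)
Lemma banach_limit_exists (R : realType) : exists L, @banach_limit R L.
Proof.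
have [U [UU oU]] := @ultraFilterLemma _ (@nbhs nat _ \oo) _.
have UP : ProperFilter U by exact: ultra_proper.
have cvgU (u : nat -> R) : bounded_seq u -> cvg (u n @[n --> U]).
  move=> [M uM].
  have UI : (u n @[n --> U]) `[- M, M]%classic.
    apply: (@filterE _ U _ (u @^-1` `[- M, M]%classic)) => n.
    by rewrite /= in_itv/= -ler_norml.
  (* A finer filter containing a set outside the image filter would also contain its complement. *)
  have uU : UltraFilter (u n @[n --> U]).
    apply: Build_UltraFilter => G GP uG; apply/seteqP; split=> A; last exact: uG.
    move=> GA; have [//|nA] := in_ultra_setVsetC (u @^-1` A) UU.
    have G0 : G set0 by rewrite -(setICr A); exact: (@filterI _ G _ A (~` A) GA (uG (~` A) nA)).
    by have /(_ GP G0) := @filter_not_empty _ G.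
  have := @segment_compact R (- M) M; rewrite compact_ultra => /(_ _ uU UI).
  by move=> [l [_ ul]]; apply/cvg_ex; exists l.
exists (fun u => lim (u n @[n --> U])).
split=> [a u v bu bv|u c bu uc|u c uc|u c uc].
- apply: cvg_lim => //; apply: cvgD; last exact: cvgU.
  by apply: cvgZl_tmp; exact: cvgU.
- by apply: limr_le; [exact: cvgU|exact: oU].
- by apply: cvg_lim => //; apply: cvg_near_cst; exact: oU.
- have cu : cvg (u n @[n --> U]) by apply: cvgU; exists c.
  rewrite ler_norml; apply/andP; split; [apply: limr_ge => //|apply: limr_le => //];
    apply: filterE => n; by have := uc n; rewrite ler_norml => /andP[].
Qed.

(** * Dual spaces, non-reflexivity and quotients *)

Section dual_facts.
Context (R : realType) (V : normedModType R).

Lemma dual_of_bound (f : V -> R) (C : R) : linear (f : V -> R^o) ->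
  (forall x, `|f x| <= C * `|x|) -> exists g : dual V, forall x, g x = f x.
Proof.
move=> lf fC.
pose f' : {linear V -> R^o} := HB.pack (f : V -> R^o) (GRing.isLinear.Build R V R^o _ _ lf).
have cf : continuous f'.
  apply/linear_bounded_continuous/linear_boundedP.
  have := @nbhs_pinfty_ge R C (num_real C); apply: filterS => r Cr x.
  by apply: le_trans (fC x) _; rewrite ler_wpM2r.
have fd : f \in @dual_pred R V by apply/asboolP; split.
by exists (Dual fd).
Qed.

Lemma dual_norm_mul (f : dual V) x : `|f x| <= `|f| * `|x|.
Proof.
have [->|x0] := eqVneq x 0; first by rewrite linear0 !normr0 mulr0.
have nx : 0 < `|x| by rewrite normr_gt0.
rewrite -ler_pdivrMr//.
have -> : `|f x| / `|x| = `|f (`|x|^-1 *: x)|.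
  by rewrite linearZ/= normrM normfV normr_id mulrC.
by apply: dual_norm_ub; rewrite normrZ normfV normr_id mulVf// gt_eqF.
Qed.

Lemma dual_norm_bound (f : dual V) c :
  (forall x, `|f x| <= c * `|x|) -> 0 <= c -> `|f| <= c.
Proof.
move=> fc c0; apply: dual_norm_le => x x1; apply: le_trans (fc x) _.
by rewrite ler_piMr.
Qed.

End dual_facts.

Section ultralimits.
Context (R : realType) (V : normedModType R).

(** Boundedness is carried through the induction because linearity of [L] requires it at each
    step. *)
Lemma banach_limit_sum (L : (nat -> R) -> R) (I : Type) (r : seq I) (a : I -> R)
    (u : I -> nat -> R) : banach_limit L -> (forall i, bounded_seq (u i)) ->
  bounded_seq (fun n => \sum_(i <- r) a i * u i n) /\
  L (fun n => \sum_(i <- r) a i * u i n) = \sum_(i <- r) a i * L (u i).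
Proof.
move=> bL bu; elim: r => [|i r [[M rM] IH]].
  split; first by exists 0 => n; rewrite big_nil normr0.
  by rewrite big_nil; apply: (banach_limit_eq bL); apply: nearW => n; rewrite big_nil.
rewrite (_ : (fun n => _) = fun n => a i * u i n + \sum_(j <- r) a j * u j n); last first.
  by apply/funext => n; rewrite big_cons.
split; last by rewrite big_cons (banach_limit_linear bL) ?IH//; exists M.
have [M' iM] := bu i; exists (`|a i| * M' + M) => n.
by apply: le_trans (ler_normD _ _) _; rewrite lerD// normrM ler_wpM2l.
Qed.

(** A weak-* limit of the bounded sequence [x] in the bidual, taken pointwise on functionals. *)
Lemma bidual_limit (L : (nat -> R) -> R) (x : nat -> V) (C : R) :
  banach_limit L -> (forall n, `|x n| <= C) ->
  exists G : dual (dual V), forall f : dual V, G f = L (fun n => f (x n)).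
Proof.
move=> bL xC.
have fb (f : dual V) n : `|f (x n)| <= C * `|f|.
  by apply: le_trans (dual_norm_mul f _) _; rewrite mulrC ler_wpM2r.
have bf (f : dual V) : bounded_seq (fun n => f (x n)) by exists (C * `|f|).
apply: (@dual_of_bound R (dual V) (fun f => L (fun n => f (x n))) C) => [a f g|f].
- by rewrite -[RHS](banach_limit_linear bL).
- by apply: (banach_limit_norm bL) => n; exact: fb.
Qed.

(* The easy half of James' criterion: a limit v of w in the bidual has g_k(v) = 1 for all
   k, yet a limit h of the g_k kills every w_n, hence v. *)
Lemma not_reflexive_triangular (w : nat -> V) (g : nat -> dual V) (C D : R) :
  (forall n, `|w n| <= C) -> (forall k, `|g k| <= D) ->
  (forall k n, g k (w n) = (k <= n)%N%:R) -> ~ reflexive_space V.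
Proof.
move=> wC gD gw rV; have [L bL] := banach_limit_exists R.
have [G GE] := bidual_limit bL wC; have [v Gv] := rV G.
have gb x k : `|g k x| <= D * `|x|.
  by apply: le_trans (dual_norm_mul _ _) _; rewrite ler_wpM2r.
have bg x : bounded_seq (fun k => g k x) by exists (D * `|x|).
have [|x|h hE] := dual_of_bound (f := fun x => L (fun k => g k x)) (C := D).
- move=> a x y; rewrite -[RHS](banach_limit_linear bL)//; congr L.
  by apply/funext => k; rewrite linearP.
- by apply: (banach_limit_norm bL) => k; exact: gb.
have hv1 : h v = 1.
  rewrite hE; apply: (banach_limit_eq bL); apply: nearW => k.
  rewrite -Gv GE; apply: (banach_limit_eq bL).
  by exists k => // n /= kn; rewrite gw kn.
have : h v = 0.
  rewrite -Gv GE; apply: (banach_limit_eq bL); apply: nearW => n.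
  rewrite hE; apply: (banach_limit_eq bL); exists n.+1 => // k /= nk.
  by rewrite gw leqNgt nk.
by rewrite hv1 => /eqP; rewrite oner_eq0.
Qed.

End ultralimits.

(** Such a [g] is constant on cosets, and its norm does not grow because the quotient norm is an
    infimum over representatives. *)
Lemma quotient_functional (R : realType) (V : normedModType R)
    (Y : closed_subspace V) (g : dual V) :
  (forall y, y \in (Y : submodClosed V) -> g y = 0) ->
  exists h : dual (quotient_space Y),
    `|h| <= `|g| /\ forall x, h (\pi_(quotient_space Y) x)%qT = g x.
Proof.
move=> gY; pose Q := quotient_space Y.
have gpi x y : (\pi_Q x = \pi_Q y)%qT -> g x = g y.
  move=> /eqP; rewrite -[_ == _]lquotBE => /gY; rewrite linearB/=.
  by move=> /eqP; rewrite subr_eq0 => /eqP.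
have grepr x : g (repr (\pi_Q x)%qT) = g x by apply: gpi; rewrite reprK.
have gnorm (u : Q) : `|g (repr u)| <= `|g| * `|u|.
  have [g0|g0] := eqVneq (`|g|) 0.
    by apply: le_trans (dual_norm_mul _ _) _; rewrite g0 !mul0r.
  rewrite -ler_pdivrMl ?lt_def ?g0 ?normr_ge0//.
  apply: lb_le_inf; first by exists `|repr u|, (repr u) => //=; rewrite reprK.
  move=> _ [x /= xu <-]; rewrite -xu grepr ler_pdivrMl ?lt_def ?g0 ?normr_ge0//.
  exact: dual_norm_mul.
have [|h hE] := dual_of_bound (f := fun u : Q => g (repr u)) _ gnorm.
  move=> a u v.
  rewrite -{1}[u]reprK -{1}[v]reprK -(pi_quotZ Y) -(pi_quotD Y).
  by rewrite grepr linearP.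
exists h; split=> [|x]; last by rewrite hE grepr.
by apply: dual_norm_bound => // u; rewrite hE.
Qed.

(** The triangular system descends to the quotient with the same bounds: projecting does not
    increase norms, and the [g k] factor. *)
Lemma quotient_not_reflexive (R : realType) (V : normedModType R)
    (Y : closed_subspace V) (w : nat -> V) (g : nat -> dual V) (C D : R) :
  (forall n, `|w n| <= C) -> (forall k, `|g k| <= D) ->
  (forall k y, y \in (Y : submodClosed V) -> g k y = 0) ->
  (forall k n, g k (w n) = (k <= n)%N%:R) -> ~ reflexive_space (quotient_space Y).
Proof.
move=> wC gD gY gw; pose Q := quotient_space Y.
have [h hP] := choice (fun k => quotient_functional (gY k)).
apply: (@not_reflexive_triangular _ _ (fun n => \pi_Q (w n))%qT h C D).
- move=> n; apply: le_trans (wC n); apply: ge_inf.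
    by exists 0 => _ [x _ <-].
  by exists (w n).
- by move=> k; apply: le_trans (gD k); have [] := hP k.
- by move=> k n; have [_ ->] := hP k.
Qed.

(** * 1-symmetric bases and their fundamental function *)

Section symmetric_basis_facts.
Context (R : realType) (X : normedModType R) (e : symmetric_basis X).

Definition fundamental_fun (k : nat) : R := `|\sum_(i < k) e i|.
Local Notation F := fundamental_fun.

Lemma fundamental_fun_ge0 k : 0 <= F k. Proof. exact: normr_ge0. Qed.

(** Were [e 0] zero, both the zero sequence and the indicator of 0 would be coefficients of the
    vector 0, against uniqueness. *)
Lemma basis_neq0 : e 0%N != 0.
Proof.
apply/eqP => e0; have [c [_ c_uniq]] := basis_schauder e 0.
have cvg0 (a : nat -> R) : (forall i, a i *: e i = 0) ->
    series (fun n => a n *: e n) @ \oo --> (0 : X).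
  move=> ae; apply: cvg_near_cst; apply: nearW => n.
  by rewrite /series/= big1.
have := c_uniq _ (cvg0 (fun=> 0) (fun i => scale0r _)).
have -> : c = fun i => (i == 0%N)%:R.
  by apply: c_uniq; apply: cvg0 => -[|i]; rewrite ?e0 ?scaler0 ?scale0r.
by move=> /(congr1 (fun a => a 0%N)) /eqP; rewrite oner_eq0.
Qed.

(** Symmetry is given for bijections of [nat], so [s] is extended by the identity beyond [N]. *)
Lemma basis_perm N (a : 'I_N -> R) (s : {perm 'I_N}) :
  `|\sum_i a i *: e (s i)| = `|\sum_i a i *: e i|.
Proof.
pose ext (s : {perm 'I_N}) (k : nat) : nat :=
  if insub k is Some i then s i else k.
have ext_ord t (i : 'I_N) : ext t i = t i by rewrite /ext valK.
have extK t : cancel (ext t) (ext t^-1%g).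
  move=> k; case: (ltnP k N) => [kN|Nk]; last by rewrite /ext !insubN// -leqNgt.
  by rewrite (ext_ord t (Ordinal kN)) ext_ord permK.
have bs : bijective (ext s).
  by exists (ext s^-1%g); [exact: extK|rewrite -{2}(invgK s); exact: extK].
have := basis_symmetric e N (fun n => oapp a 0 (insub n)) (fun=> false) bs.
under eq_bigr do rewrite expr0 mul1r valK ext_ord /=.
by under [in RHS]eq_bigr do rewrite valK /=.
Qed.

(** Coefficients are replaced one at a time. If |x| <= |y|, then x is a convex combination of y and
    -y, and these two choices of one coefficient give equal norms by sign invariance. *)
Lemma basis_monotone N (a b : nat -> R) : (forall i, `|a i| <= `|b i|) ->
  `|\sum_(i < N) a i *: e i| <= `|\sum_(i < N) b i *: e i|.
Proof.
move=> ab; pose nm (u : nat -> R) := `|\sum_(i < N) u i *: e i|.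
pose upd (u : nat -> R) m x i := if i == m then x else u i.
have updN u m y : nm (upd u m (- y)) = nm (upd u m y).
  rewrite /nm -(basis_symmetric e N (upd u m y) (fun i => i == m) (s := id)).
    congr (`|_|); apply: eq_bigr => i _; rewrite /upd.
    by case: eqP; rewrite ?expr0 ?expr1 ?mulN1r ?mul1r.
  by exists id.
have nm_upd u m x y : `|x| <= `|y| -> nm (upd u m x) <= nm (upd u m y).
  have [->|y0 xy] := eqVneq y 0; first by rewrite normr0 normr_le0 => /eqP ->.
  have [l [l0 l1 lx]] : exists l, [/\ 0 <= l, 0 <= 1 - l & x = l * y + (1 - l) * - y].
    exists ((1 + x / y) / 2).
    have : `|x / y| <= 1 by rewrite normrM normfV ler_pdivrMr ?normr_gt0// mul1r.
    rewrite ler_norml => /andP[xy1 xy2].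
    by split; [lra|lra|field].
  have -> : nm (upd u m x) =
      `|l *: (\sum_(i < N) upd u m y i *: e i) +
        (1 - l) *: (\sum_(i < N) upd u m (- y) i *: e i)|.
    rewrite /nm !scaler_sumr -big_split/=; congr (`|_|); apply: eq_bigr => i _.
    rewrite !scalerA -scalerDl; congr (_ *: _); rewrite /upd.
    by case: ifP => _; [exact: lx|ring].
  apply: le_trans (ler_normD _ _) _.
  rewrite !normrZ -[`|\sum_(i < N) upd u m y i *: e i|]/(nm _).
  rewrite -[`|\sum_(i < N) upd u m (- y) i *: e i|]/(nm _) updN.
  by rewrite (ger0_norm l0) (ger0_norm l1) -mulrDl addrCA subrr addr0 mul1r.
have hyb m : nm (fun i => if (i < m)%N then a i else b i) <= nm b.
  elim: m => [|m IH]; first by [].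
  set h := fun i => _ in IH.
  rewrite (_ : (fun i => _) = upd h m (a m)); last first.
    apply/funext => i; rewrite /upd /h ltnS leq_eqVlt.
    by case: eqP => [->|].
  apply: le_trans (nm_upd _ _ _ (b m) (ab m)) _.
  rewrite (_ : upd h m (b m) = h)//; apply/funext => i; rewrite /upd /h.
  by case: eqP => // ->; rewrite ltnn.
apply: le_trans (hyb N); rewrite le_eqVlt; apply/orP; left; apply/eqP.
by rewrite /nm; congr (`|_|); apply: eq_bigr => i _; rewrite ltn_ord.
Qed.

Lemma basis_const N (c : R) :
  `|\sum_(i < N) c *: e i| = `|c| * F N.
Proof. by rewrite -scaler_sumr normrZ. Qed.

(* Average over the cyclic shifts of the coefficients. *)
Lemma l1_lower_bound N (a : nat -> R) :
  (\sum_(i < N) `|a i|) * F N <= N%:R * `|\sum_(i < N) a i *: e i|.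
Proof.
case: N => [|N]; first by rewrite !big_ord0 mul0r.
have -> : `|\sum_(i < N.+1) a i *: e i| = `|\sum_(i < N.+1) `|a i| *: e i|.
  apply/eqP; rewrite eq_le (@basis_monotone _ a (fun i => `|a i|)) => [|i].
    by rewrite (@basis_monotone _ (fun i => `|a i|) a)// => i; rewrite normr_id.
  by rewrite normr_id.
have tr (r : 'I_N.+1) : `|\sum_(i < N.+1) `|a i| *: e (r + i)%R| =
                        `|\sum_(i < N.+1) `|a i| *: e i|.
  pose s := perm (@addrI _ r).
  rewrite -(basis_perm (fun i : 'I_N.+1 => `|a i|) s).
  by congr (`|_|); apply: eq_bigr => i _; rewrite permE.
have -> : N.+1%:R * `|\sum_(i < N.+1) `|a i| *: e i| =
    \sum_(r < N.+1) `|\sum_(i < N.+1) `|a i| *: e (r + i)%R|.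
  by rewrite (eq_bigr _ (fun r _ => tr r)) sumr_const card_ord mulr_natl.
apply: le_trans (ler_norm_sum _ _ _).
rewrite exchange_big/= (eq_bigr (fun i : 'I_N.+1 => `|a i| *: \sum_(j < N.+1) e j)).
  by rewrite -scaler_suml normrZ ger0_norm// sumr_ge0.
move=> i _; rewrite -scaler_sumr; congr (_ *: _).
by rewrite [RHS](reindex_inj (@addIr _ i)).
Qed.

(** Otherwise [l1_lower_bound] makes the norm dominate a multiple of the l^1 norm, so summing the
    coefficients from index k on is bounded uniformly in k. Together with the vectors [e n], these
    tail functionals form the system of [not_reflexive_triangular]. *)
Lemma fundamental_fun_small (eta : R) : reflexive_space X -> 0 < eta ->
  exists2 k, (0 < k)%N & F k <= eta * k%:R.
Proof.
move=> rX eta0; apply: contrapT => nk.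
have Fk k : eta * k%:R <= F k.
  case: k => [|k]; first by rewrite mulr0 fundamental_fun_ge0.
  by rewrite leNgt; apply/negP => /ltW h; apply: nk; exists k.+1.
have low N (a : nat -> R) :
    eta * (\sum_(i < N) `|a i|) <= `|\sum_(i < N) a i *: e i|.
  case: N => [|N]; first by rewrite !big_ord0 mulr0.
  rewrite -(@ler_pM2l _ N.+1%:R) ?ltr0n//.
  apply: le_trans (l1_lower_bound _ _).
  by rewrite mulrCA mulrA mulrC ler_wpM2l// sumr_ge0.
have [c cP] := choice (fun x => basis_schauder e x).
have c_cvg x := proj1 (cP x); have c_uniq x := proj2 (cP x).
have c_lin a x y : c (a *: x + y) = fun n => a * c x n + c y n.
  apply: c_uniq.
  rewrite (_ : series _ = (fun n => a *: series (fun n => c x n *: e n) n +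
                                    series (fun n => c y n *: e n) n)).
    by apply: cvgD (c_cvg y); apply: cvgZl_tmp; exact: c_cvg.
  apply/funext => n; rewrite /series/= scaler_sumr -big_split/=.
  by apply: eq_bigr => i _; rewrite scalerDl scalerA.
have c_e n : c (e n) = fun i => (i == n)%:R.
  apply: c_uniq; apply: cvg_near_cst; exists n.+1 => // m /= nm.
  rewrite /series/= (bigD1_seq n) ?mem_index_iota ?iota_uniq//= eqxx scale1r.
  by rewrite big1 ?addr0// => i /negbTE ->; rewrite scale0r.
(* For m >= n, [low] bounds the sum by the norm of the m-th partial sum of the expansion, which
   tends to [|x|]. *)
have c_sum x n : \sum_(i < n) `|c x i| <= eta^-1 * `|x|.
  rewrite ler_pdivlMl//.
  have h : `|series (fun n => c x n *: e n) m| @[m --> \oo] --> `|x|.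
    exact: cvg_norm (c_cvg x).
  rewrite -(cvg_lim _ h)//; apply: limr_ge; first by apply/cvg_ex; exists `|x|.
  exists n => // m /= nm; rewrite /series/= big_mkord; apply: le_trans (low _ _).
  rewrite ler_wpM2l ?(ltW eta0)// -!(big_mkord xpredT (fun i => `|c x i|)).
  by rewrite [leRHS](@big_cat_nat _ _ _ n)//= lerDl sumr_ge0.
have [L [Llin _ Leq Lnorm]] := banach_limit_exists R.
(* Partial sums of the k-th tail functional; applying [L] to them gives a value without a separate
   convergence argument. *)
pose tl k x n := \sum_(i < n) (k <= i)%:R * c x i.
have tl_le k x n : `|tl k x n| <= eta^-1 * `|x|.
  apply: le_trans (c_sum x n); apply: le_trans (ler_norm_sum _ _ _) _.
  by apply: ler_sum => i _; rewrite normrM ler_piMl//; case: (k <= i)%N; rewrite ?normr1 ?normr0.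
have tl_bnd k x : bounded_seq (tl k x) by exists (eta^-1 * `|x|).
have /choice[g gE] : forall k, exists g : dual X, forall x, g x = L (tl k x).
  move=> k; apply: (dual_of_bound (C := eta^-1)) => [a x y|x].
    rewrite -[RHS]Llin//; congr L; apply/funext => n.
    rewrite /tl c_lin mulr_sumr -big_split/=; apply: eq_bigr => i _; ring.
  by apply: Lnorm => n; exact: tl_le.
apply: (@not_reflexive_triangular _ X e g `|e 0%N| eta^-1) => //.
- by move=> n; rewrite basis_norm.
- move=> k; apply: dual_norm_bound; last by rewrite invr_ge0 ltW.
  by move=> x; rewrite gE; apply: Lnorm => n; exact: tl_le.
move=> k n; rewrite gE.
apply: Leq.
exists n.+1 => // m /= nm; rewrite /tl (bigD1 (Ordinal nm))//= c_e eqxx mulr1.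
rewrite big1 ?addr0// => i; rewrite -val_eqE/= => /negbTE ->.
by rewrite mulr0.
Qed.

End symmetric_basis_facts.

(** * Basis norms estimated by the sup and l^1 norms of the coefficients *)

Section block_estimate.
Context (R : realType) (X : normedModType R) (e : symmetric_basis X).
Local Notation F := (fundamental_fun e).

(** Coefficients are kept in a list so that they can be sorted, cut and concatenated. *)
Definition basis_norm_seq (v : seq R) : R := `|\sum_(i < size v) v`_i *: e i|.
Local Notation nm := basis_norm_seq.

Lemma basis_norm_seq_perm v w : perm_eq v w -> nm v = nm w.
Proof.
rewrite -[w]/(val (in_tuple w)) => /tuple_permP[p ->].
rewrite /nm size_tuple -(basis_perm _ (fun i => (in_tuple w)`_i) p^-1%g).
rewrite [in RHS](reindex_inj (@perm_inj _ p)) /=; congr (`|_|).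
apply: eq_bigr => i _; rewrite permK; congr (_ *: _).
by rewrite (nth_map i) ?size_enum_ord// nth_ord_enum (tnth_nth 0).
Qed.

(** Beyond the end of [v], [nth] returns the default 0, so the added terms vanish. *)
Lemma basis_norm_seq_pad v N : (size v <= N)%N ->
  \sum_(i < size v) v`_i *: e i = \sum_(i < N) v`_i *: e i.
Proof.
move=> vN; rewrite -!(big_mkord xpredT (fun i => v`_i *: e i)).
rewrite [RHS](@big_cat_nat _ _ _ (size v))//= [X in _ = _ + X]big1_seq ?addr0//.
by move=> i; rewrite mem_index_iota => /andP[_ /andP[vi _]]; rewrite nth_default ?scale0r.
Qed.

(** By symmetry [w] may be shifted behind [size v] zeros without changing its norm; then the
    triangle inequality applies. *)
Lemma basis_norm_seq_cat v w : nm (v ++ w) <= nm v + nm w.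
Proof.
have -> : nm w = nm (nseq (size v) 0 ++ w).
  rewrite (@basis_norm_seq_perm (nseq (size v) 0 ++ w) (w ++ nseq (size v) 0)); last by rewrite perm_catC.
  rewrite /nm (@basis_norm_seq_pad w (size (w ++ nseq (size v) 0))).
    congr (`|_|); apply: eq_bigr => i _; rewrite nth_cat nth_nseq if_same.
    by case: ltnP => // wi; rewrite nth_default.
  by rewrite size_cat leq_addr.
rewrite {2}/nm (@basis_norm_seq_pad v (size (v ++ w))) ?size_cat ?leq_addr//.
rewrite /nm !size_cat size_nseq; apply: le_trans (ler_normD _ _).
rewrite -big_split/= le_eqVlt; apply/orP; left; apply/eqP; congr (`|_|).
apply: eq_bigr => i _; rewrite -scalerDl !nth_cat size_nseq nth_nseq if_same.
by case: ltnP => vi; rewrite ?addr0// [v`_i]nth_default ?add0r.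
Qed.

Lemma basis_norm_seq_le v c k : (size v <= k)%N -> 0 <= c ->
  (forall x, x \in v -> `|x| <= c) -> nm v <= c * F k.
Proof.
move=> vk c0 vc; rewrite /nm (basis_norm_seq_pad vk).
rewrite -[c in leRHS](ger0_norm c0) -basis_const.
apply: (@basis_monotone _ _ e k (nth 0 v) (fun=> c)) => i.
rewrite (ger0_norm c0); case: (ltnP i (size v)) => iv; first by rewrite vc ?mem_nth.
by rewrite nth_default ?normr0.
Qed.

(* Cut v into blocks of length k: the entries of a block are bounded by the mean of the
   preceding block. *)
Lemma basis_block_sorted k v c : (0 < k)%N -> 0 <= c ->
  (forall x, x \in v -> `|x| <= c) -> sorted (fun x y => `|y| <= `|x|) v ->
  nm v <= F k * (c + (\sum_(x <- v) `|x|) / k%:R).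
Proof.
move=> k0; have kR : 0 < k%:R :> R by rewrite ltr0n.
have [n vn] := ubnP (size v); elim: n => // n IH in v c vn *.
move=> c0 vc sv; have [vk|kv] := leqP (size v) k.
  apply: le_trans (basis_norm_seq_le vk c0 vc) _; rewrite mulrC.
  by rewrite ler_wpM2l ?fundamental_fun_ge0// lerDl divr_ge0// sumr_ge0.
(* The last entry of the first block: after sorting it bounds all entries beyond the block and is at
   most each entry inside it. *)
pose c' := `|v`_k.-1|.
have tr : transitive (fun x y : R => `|y| <= `|x|).
  by move=> y x z yx zy; apply: le_trans zy yx.
have srt i j : (i <= j)%N -> (j < size v)%N -> `|v`_j| <= `|v`_i|.
  move=> ij js; apply: (sorted_leq_nth tr _ 0 sv) => //; rewrite ?inE//.
  exact: leq_ltn_trans js.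
rewrite -{1 2}(cat_take_drop k v) big_cat/=.
apply: le_trans (basis_norm_seq_cat _ _) _.
have vt : nm (take k v) <= c * F k.
  apply: basis_norm_seq_le => //; first by rewrite size_take_min geq_minl.
  by move=> x /mem_take; exact: vc.
have vd : nm (drop k v) <= F k * (c' + (\sum_(x <- drop k v) `|x|) / k%:R).
  apply: IH; last exact: drop_sorted.
  - rewrite size_drop; move: vn; rewrite ltnS; apply: leq_trans.
    by rewrite ltn_subrL k0 (leq_trans k0 (ltnW kv)).
  - exact: normr_ge0.
  - move=> x /(nthP 0)[i]; rewrite size_drop nth_drop => ik <-.
    apply: srt; last by rewrite -ltn_subRL.
    by apply: leq_trans (leq_pred k) _; exact: leq_addr.
have ct : c' * k%:R <= \sum_(x <- take k v) `|x|.
  rewrite (big_nth 0) size_takel ?(ltnW kv)// mulr_natr -[X in _ *+ X]card_ord -sumr_const.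
  rewrite big_mkord; apply: ler_sum => i _; rewrite nth_take//.
  apply: srt; first by rewrite -ltnS prednK.
  by apply: leq_ltn_trans kv; rewrite leq_pred.
apply: le_trans (lerD vt vd) _; rewrite [c * _]mulrC -mulrDr.
rewrite ler_wpM2l ?fundamental_fun_ge0// lerD2l mulrDl lerD2r.
by rewrite ler_pdivlMr.
Qed.

(** Sorting by decreasing absolute value changes neither the norm nor the l^1 sum, so the sorted
    case suffices. *)
Lemma basis_block (k m : nat) (v : 'I_m -> R) (c : R) : (0 < k)%N -> 0 <= c ->
  (forall j, `|v j| <= c) ->
  `|\sum_(j < m) v j *: e j| <= F k * (c + (\sum_(j < m) `|v j|) / k%:R).
Proof.
move=> k0 c0 vc; pose s := [seq v j | j : 'I_m]; pose r (x y : R) := `|y| <= `|x|.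
have ss : size s = m by rewrite size_map size_enum_ord.
have sE (j : 'I_m) : s`_j = v j.
  by rewrite (nth_map j) ?size_enum_ord// nth_ord_enum.
have -> : `|\sum_(j < m) v j *: e j| = nm (sort r s).
  rewrite -(@basis_norm_seq_perm s); last by rewrite perm_sym perm_sort.
  by rewrite /nm ss; congr (`|_|); apply: eq_bigr => j _; rewrite sE.
have -> : \sum_(j < m) `|v j| = \sum_(x <- sort r s) `|x|.
  by rewrite (perm_big s) ?perm_sort//= /s big_map big_enum.
apply: basis_block_sorted => //.
  by move=> x; rewrite mem_sort => /mapP[j _ ->].
by apply: sort_sorted => x y; exact: le_total.
Qed.

End block_estimate.

(** * Functionals on a completion *)

Section completion_facts.
Context (R : realType) (V : lmodType R) (p : seminorm V).

Fact const_cauchy (v : V) : (fun=> v) \in cauchy_pred p.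
Proof. by apply/asboolP => e e0; exists 0%N => m n _ _; rewrite subrr seminorm0. Qed.

Definition completion_inj (v : V) : completion p :=
  (\pi_(completion p) (CauchySeq (const_cauchy v)))%qT.
Local Notation inj := completion_inj.

Lemma completion_inj_linear a u v : inj (a *: u + v) = a *: inj u + inj v.
Proof.
rewrite /inj -[X in _ = X + _](pi_quotZ (@null_seq _ _ p)) -[RHS](pi_quotD (@null_seq _ _ p)).
by congr (\pi_(completion p) _)%qT; exact: val_inj.
Qed.

Lemma completion_inj_sum (I : Type) (r : seq I) (a : I -> R) (v : I -> V) :
  inj (\sum_(i <- r) a i *: v i) = \sum_(i <- r) a i *: inj (v i).
Proof.
elim: r => [|i r IH]; last by rewrite !big_cons completion_inj_linear IH.
have := completion_inj_linear (-1) 0 0.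
by rewrite !big_nil scaler0 addr0 scaleN1r addNr.
Qed.

Lemma completion_norm_pi (c : cauchy_seq p) :
  `|(\pi_(completion p) c)%qT : completion p| = cauchy_norm c.
Proof. exact: (seminorm_repr (@null_seqP _ _ p)). Qed.

Lemma completion_inj_norm v : `|inj v| = p v.
Proof. rewrite completion_norm_pi. exact: (@lim_cst _ (@Rhausdorff R) nat (@nbhs nat _ \oo) _ (p v)). Qed.

(** Extension by density: take the limit of [l] along a Cauchy sequence; the bound by [C] makes it
    independent of the representative. *)
Lemma completion_extend (l : V -> R) (C : R) :
  (forall a u v, l (a *: u + v) = a * l u + l v) ->
  (forall v, `|l v| <= C * p v) ->
  exists f : dual (completion p), (forall x, `|f x| <= C * `|x|) /\
    forall v, f (inj v) = l v.
Proof.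
move=> ll lC; have l0 : l 0 = 0.
  by have := ll (-1) 0 0; rewrite scaler0 addr0 mulN1r addNr.
have lB u v : l (u - v) = l u - l v.
  have lN w : l (- w) = - l w by have := ll (-1) w 0; rewrite l0 !addr0 scaleN1r mulN1r.
  by have := ll 1 u (- v); rewrite scale1r mul1r lN.
(* [C] may be zero or negative, so this serves as the divisor. *)
have C'0 : 0 < `|C| + 1 by rewrite ltr_wpDl.
have lcvg (c : cauchy_seq p) : cvgn (fun n => l (c n)).
  have /asboolP cc := cauchy_funP c.
  apply/cauchy_cvgP/cauchyP => e e0.
  have [N cN] := cc (e / (`|C| + 1)) ltac:(by rewrite divr_gt0).
  exists (l (c N)); exists N => // n /= Nn; rewrite /ball/= -lB.
  apply: le_lt_trans (lC _) _.
  have := cN _ _ (leqnn N) Nn; rewrite ltr_pdivlMr// mulrC; apply: le_lt_trans.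
  by rewrite ler_wpM2r ?seminorm_ge0// (le_trans (ler_norm _))// lerDl.
pose L (c : cauchy_seq p) := limn (fun n => l (c n)).
have Llin a c d : L (a *: c + d) = a * L c + L d.
  apply: cvg_lim => //; rewrite (_ : (fun n => _) = fun n => a * l (c n) + l (d n)).
    by apply: cvgD; [apply: cvgZl_tmp|]; exact: lcvg.
  by apply/funext => n; rewrite -ll.
have LC c : `|L c| <= C * cauchy_norm c.
  have -> : `|L c| = limn (fun n => `|l (c n)|).
    by apply/esym/cvg_lim => //; apply: cvg_norm; exact: lcvg.
  rewrite /cauchy_norm -[leRHS]limZl_tmp; last exact: cauchy_norm_cvg.
  apply: ler_lim; [exact: is_cvg_norm (lcvg c)|apply: is_cvgZl_tmp; exact: cauchy_norm_cvg|].
  by apply: nearW => n; exact: lC.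
have Lpi c d : (\pi_(completion p) c = \pi_(completion p) d)%qT -> L c = L d.
  move=> /eqP; rewrite -[_ == _](lquotBE (@null_seq _ _ p)) => /null_seqP cd.
  have := LC (c - d); rewrite [cauchy_norm _]cd mulr0 normr_le0.
  rewrite (_ : c - d = (-1) *: d + c) ?Llin ?mulN1r; last by rewrite scaleN1r addrC.
  by rewrite addrC subr_eq0 => /eqP.
have fC (u : completion p) : `|L (repr u)| <= C * `|u|.
  by rewrite -{2}[u]reprK completion_norm_pi; exact: LC.
have [|f fE] := dual_of_bound (f := fun u : completion p => L (repr u)) _ fC.
  move=> a u v; rewrite -[RHS]Llin; apply: Lpi; rewrite reprK.
  by rewrite -{1}[u]reprK -{1}[v]reprK -(pi_quotZ (@null_seq _ _ p)) -(pi_quotD (@null_seq _ _ p)).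
exists f; split=> [x|v]; first by rewrite fE.
rewrite fE (@Lpi _ (CauchySeq (const_cauchy v))) ?reprK//.
exact: (@lim_cst _ (@Rhausdorff R) nat (@nbhs nat _ \oo) _ (l v)).
Qed.

End completion_facts.

(** * Volumes and indicators of boxes *)

Lemma sum_measureI_le (R : realType) d (T : measurableType d)
    (mu : {measure set T -> \bar R}) m (B : set T) (A : 'I_m -> set T) :
  measurable B -> (mu B < +oo)%E -> (forall j, measurable (A j)) ->
  trivIset setT A -> \sum_(j < m) fine (mu (B `&` A j)) <= fine (mu B).
Proof.
move=> mB Boo mA tA.
have Ioo j : mu (B `&` A j) \is a fin_num.
  rewrite ge0_fin_numE//; apply: le_lt_trans Boo.
  by apply: le_measure; rewrite ?inE//; exact: measurableI.
rewrite -lee_fin -sumEFin fineK ?ge0_fin_numE//.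
rewrite (eq_bigr (fun j => mu (B `&` A j))); last by move=> j _; rewrite fineK.
have mBA j : measurable (B `&` A j) by exact: measurableI.
rewrite -(@measure_bigsetU_ord _ _ _ mu m xpredT (fun j => B `&` A j))//.
  apply: le_measure; rewrite ?inE//; first exact: bigsetU_measurable.
  by rewrite -bigcup_seq => x [j _ []].
exact: trivIset_setIl.
Qed.

(* Locked so that unification does not unfold the recursive construction of the measure. *)
HB.lock Definition vol (R : realType) n (A : set 'rV[R]_n) : R :=
  fine (lebesgue_rV R n A).

Section boxes.
Context (R : realType).

Definition box n (a b : 'rV[R]_n) : set 'rV[R]_n :=
  [set x : 'rV[R]_n | forall i, a 0 i < x 0 i < b 0 i].

Definition tail n (x : 'rV[R]_n.+1) : 'rV[R]_n := \row_j x 0 (lift ord0 j).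

(** The product of [A] and [B], separating the first axis, along which jumps are taken, from the
    others. *)
Definition cyl n (A : set R) (B : set 'rV[R]_n) : set 'rV[R]_n.+1 :=
  [set x : 'rV[R]_n.+1 | A (x 0 ord0) /\ B (tail x)].

Lemma cylI n A B A' B' : @cyl n A B `&` cyl A' B' = cyl (A `&` A') (B `&` B').
Proof. by apply/seteqP; split=> x [] [? ?] [? ?]. Qed.

Lemma cyl0 n B : @cyl n set0 B = set0.
Proof. by apply/seteqP; split=> x []. Qed.

Lemma box_cyl n (a b : 'rV[R]_n.+1) :
  box a b = cyl `]a 0 ord0, b 0 ord0[ (box (tail a) (tail b)).
Proof.
apply/seteqP; split=> x /=.
  move=> xab; split; first by rewrite /= in_itv/=; exact: xab.
  by move=> i; rewrite !mxE; exact: xab.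
move=> [x0 xs] i; have [j ->|->] := unliftP ord0 i; last by move: x0; rewrite /= in_itv.
by have := xs j; rewrite !mxE.
Qed.

Lemma measurable_box n (a b : 'rV[R]_n) : (forall i, a 0 i < b 0 i) ->
  measurable (box a b).
Proof.
by move=> ab; apply: (@parallelepiped_measurable _ _ setT); exists a, b; split.
Qed.

(** The measure is the image of a product measure under [row_cons], and the preimage of the cylinder
    is a rectangle. *)
Lemma lebesgue_cyl n (A : set R) (B : set 'rV[R]_n) : measurable A -> measurable B ->
  lebesgue_rV R n.+1 (cyl A B) = (lebesgue_measure A * lebesgue_rV R n B)%E.
Proof.
move=> mA mB.
rewrite -[LHS]/((lebesgue_measure \x lebesgue_rV R n)%E (@row_cons R n @^-1` cyl A B)).
rewrite (_ : _ @^-1` _ = A `*` B) ?product_measure1E//.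
have tE (q : measurableTypeR R * 'rV[R]_n) : tail (row_cons q) = q.2.
  by apply/rowP => j; rewrite mxE row_consES.
by apply/seteqP; split=> -[u v]; rewrite /cyl /= row_consE0 tE.
Qed.

Lemma lebesgue_box n (a b : 'rV[R]_n) : (forall i, a 0 i < b 0 i) ->
  (0 < lebesgue_rV R n (box a b) < +oo)%E.
Proof.
elim: n a b => [|n IH] a b ab.
  rewrite /= diracE mem_set ?lte01 ?ltry//.
  by case.
have tab i : tail a 0 i < tail b 0 i by rewrite !mxE.
rewrite box_cyl lebesgue_cyl//; last exact: measurable_box.
have /andP[m0 mo] := IH _ _ tab.
rewrite lebesgue_measure_itv/= lte_fin ab -EFinD.
rewrite mule_gt0 ?lte_fin ?subr_gt0//= lte_mul_pinfty//.
  by rewrite lee_fin subr_ge0 ltW.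
Qed.

Lemma vol_ge0 n (A : set 'rV[R]_n) : 0 <= vol A.
Proof. by rewrite vol.unlock; exact: fine_ge0. Qed.

Lemma vol0 n : vol (@set0 'rV[R]_n) = 0.
Proof. by rewrite vol.unlock measure0. Qed.

Lemma vol_box_gt0 n (a b : 'rV[R]_n) : (forall i, a 0 i < b 0 i) -> 0 < vol (box a b).
Proof. by move=> ab; rewrite vol.unlock; apply: fine_gt0; exact: lebesgue_box. Qed.

Lemma vol_cyl n (c d : R) (B : set 'rV[R]_n) : c <= d -> measurable B ->
  vol (cyl `]c, d[ B) = (d - c) * vol B.
Proof.
move=> cd mB; rewrite vol.unlock lebesgue_cyl// lebesgue_measure_itv/= lte_fin.
case: ltgtP cd => // [cd _|-> _]; last by rewrite subrr mul0r mul0e.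
rewrite -EFinD; have : (0 <= lebesgue_rV R n B)%E by exact: measure_ge0.
case: (lebesgue_rV R n B) => [r _|_|]; last by rewrite leeNy_eq.
  by rewrite -EFinM.
(* When [B] has infinite measure, [fine] gives 0 on both sides. *)
by rewrite gt0_muley ?mulr0// lte_fin subr_gt0.
Qed.

Lemma measurable_cyl_box n (c d : R) (a b : 'rV[R]_n) : (forall i, a 0 i < b 0 i) ->
  measurable (cyl `]c, d[ (box a b)).
Proof.
move=> ab; have [cd|dc] := ltP c d; last first.
  by rewrite set_itv_ge ?bnd_simp -?leNgt// cyl0.
have -> : cyl `]c, d[ (box a b) = box (row_cons (c, a)) (row_cons (d, b)).
  by rewrite box_cyl !row_consE0; congr (cyl _ (box _ _));
    apply/rowP => j; rewrite mxE row_consES.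
apply: measurable_box => i; have [j ->|->] := unliftP ord0 i.
  by rewrite !row_consES.
by rewrite !row_consE0.
Qed.

Lemma lebesgue_cyl_box n (c d : R) (a b : 'rV[R]_n) : (forall i, a 0 i < b 0 i) ->
  (lebesgue_rV R n.+1 (cyl `]c, d[ (box a b)) < +oo)%E.
Proof.
move=> ab; rewrite lebesgue_cyl//; last exact: measurable_box.
have /andP[K0 Koo] := lebesgue_box ab.
rewrite lte_mul_pinfty// lebesgue_measure_itv/=; case: ifP => //.
Qed.

Lemma sum_vol_le n m (B : set 'rV[R]_n) (A : 'I_m -> set 'rV[R]_n) :
  measurable B -> (lebesgue_rV R n B < +oo)%E -> (forall j, measurable (A j)) ->
  trivIset setT A -> \sum_(j < m) vol (B `&` A j) <= vol B.
Proof. by rewrite vol.unlock; exact: sum_measureI_le. Qed.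

End boxes.

Section L1_indicators.
Context (R : realType) (d : nat) (Omega : set 'rV[R]_d) (oOmega : open Omega).
Local Notation mu := (lebesgue_rV R d).

Lemma L1_indicator (B : set 'rV[R]_d) : measurable B -> (mu B < +oo)%E ->
  exists u : L1 oOmega, forall T, parallelepipeds Omega T ->
    L1_integral T u = vol (B `&` T).
Proof.
move=> mB Boo.
have iB : (\1_B : 'rV[R]_d -> R) \in integrable_pred oOmega.
  have mO : measurable Omega := open_measurable_rV oOmega.
  apply/asboolP/integrableP; split.
    by apply/measurable_realfun.measurable_EFinP; exact: measurable_realfun.measurable_indic.
  under eq_integral do rewrite /= ger0_norm//.
  rewrite integral_indic//; apply: le_lt_trans Boo.
  by apply: le_measure; rewrite ?inE//; exact: measurableI.
exists (\pi_(L1 oOmega) (IntegrableFun iB))%qT => T PT.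
rewrite vol.unlock L1_integral_pi//= /Rintegral integral_indic//.
exact: parallelepiped_measurable PT.
Qed.

End L1_indicators.

Lemma sum_indic_unique (R : realType) (N : nat) (P : pred 'I_N) :
  (forall i j, P i -> P j -> i = j) -> \sum_(i < N) (P i)%:R <= 1 :> R.
Proof.
move=> Pu; have [/existsP[i Pi]|/existsPn nP] := boolP [exists i, P i].
  rewrite (bigD1 i)//= Pi big1 ?addr0// => j ji.
  by case: (boolP (P j)) => // /Pu/(_ Pi) jE; rewrite jE eqxx in ji.
by rewrite big1 ?ler01// => i _; rewrite (negbTE (nP i)).
Qed.

(** * Jumps across a piece of a hyperplane *)

Section jumps.
Context (R : realType) (n : nat) (Omega : set 'rV[R]_n.+2) (oOmega : open Omega).
Context (ka kb : 'rV[R]_n.+1) (kab : forall i, ka 0 i < kb 0 i).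
Local Notation K := (box ka kb).

Let K0 : 0 < vol K. Proof. exact: vol_box_gt0. Qed.
Let mK : measurable K. Proof. exact: measurable_box. Qed.

(* f has the integrals of the mean over ]t, t + eps[ x K minus the mean over
   ]t - eps, t[ x K. *)
Definition jump_fun (t eps : R) (f : L1 oOmega) := forall T, parallelepipeds Omega T ->
  L1_integral T f = (vol (cyl `]t, t + eps[ K `&` T) - vol (cyl `]t - eps, t[ K `&` T)) /
                    (eps * vol K).

Lemma jump_fun_exists t eps : exists f, jump_fun t eps f.
Proof.
have ind c d := L1_indicator oOmega (measurable_cyl_box c d kab) (lebesgue_cyl_box c d kab).
have [u uT] := ind t (t + eps); have [v vT] := ind (t - eps) t.
exists ((eps * vol K)^-1 *: ((-1) *: v + u)) => T PT.
rewrite (L1_integralZ PT) (L1_integralD PT) (L1_integralZ PT) uT// vT//.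
by rewrite mulN1r addrC mulrC.
Qed.

Section jump_estimates.
Context (t eps : R) (f : L1 oOmega) (e0 : 0 < eps) (ft : jump_fun t eps f).

Let M0 : 0 < eps * vol K. Proof. exact: mulr_gt0. Qed.

(** Disjoint sets share at most the volume [eps * vol K] of each slab, so each of the two means
    contributes at most 1. *)
Lemma jump_fun_sum_le m (T : 'I_m -> set 'rV[R]_n.+2) :
  (forall j, parallelepipeds Omega (T j)) -> trivIset setT T ->
  \sum_(j < m) `|L1_integral (T j) f| <= 2.
Proof.
move=> PT tT; have mT j := parallelepiped_measurable (PT j).
have slab_le c d := sum_vol_le (measurable_cyl_box c d kab) (lebesgue_cyl_box c d kab) mT tT.
apply: (@le_trans _ _ (\sum_(j < m) (vol (cyl `]t, t + eps[ K `&` T j) +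
    vol (cyl `]t - eps, t[ K `&` T j)) / (eps * vol K))).
  apply: ler_sum => j _; rewrite ft// normrM [X in _ * X]gtr0_norm ?invr_gt0//.
  rewrite ler_wpM2r ?invr_ge0 ?(ltW M0)//; apply: le_trans (ler_normB _ _) _.
  by rewrite !ger0_norm ?vol_ge0.
rewrite -mulr_suml ler_pdivrMr// big_split/=.
apply: le_trans (lerD (slab_le _ _) (slab_le _ _)) _.
rewrite !vol_cyl// ?lerDl ?gerBl ?(ltW e0)//.
by rewrite le_eqVlt; apply/orP; left; apply/eqP; ring.
Qed.

(** With both faces at distance at least [eps] from t, the first side of the box either misses both
    intervals around t or contains both; in the latter case the two means cancel. *)
Lemma jump_fun_local (a b : 'rV[R]_n.+2) : (forall i, a 0 i < b 0 i) ->
  parallelepipeds Omega (box a b) ->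
  eps <= `|a 0 ord0 - t| -> eps <= `|b 0 ord0 - t| -> L1_integral (box a b) f = 0.
Proof.
move=> ab PT; rewrite !ler_normr => a_t b_t; rewrite ft// (box_cyl a b) !cylI.
set I := `]a 0 ord0, _[%classic; set K' := box (tail a) _.
suff [[-> ->]|[-> ->]] :
    (`]t, t + eps[ `&` I = set0 /\ `]t - eps, t[ `&` I = set0) \/
    (`]t, t + eps[ `&` I = `]t, t + eps[%classic /\
     `]t - eps, t[ `&` I = `]t - eps, t[%classic).
- by rewrite !cyl0 subrr mul0r.
- have mK' : measurable (K `&` K').
    by apply: measurableI => //; apply: measurable_box => i; rewrite !mxE; exact: ab.
  rewrite !vol_cyl// ?lerDl ?gerBl ?(ltW e0)//.
  by rewrite (_ : t + eps - t = t - (t - eps)) ?subrr ?mul0r//; ring.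
case/orP: a_t => a_t.
  left; split; apply/seteqP; split=> // x [] /=; rewrite /I /= !in_itv/=; lra.
case/orP: b_t => b_t; last first.
  left; split; apply/seteqP; split=> // x [] /=; rewrite /I /= !in_itv/=; lra.
right; split; apply/seteqP; split=> x; rewrite /I /= !in_itv/=; lra.
Qed.

(** A box starting at t misses the left slab and spans the right one along the first axis, so only
    the position of [K] matters. *)
Lemma jump_fun_value (a b : 'rV[R]_n.+2) : parallelepipeds Omega (box a b) ->
  a 0 ord0 = t -> t + eps <= b 0 ord0 ->
  (K `<=` box (tail a) (tail b) -> L1_integral (box a b) f = 1) /\
  (K `&` box (tail a) (tail b) = set0 -> L1_integral (box a b) f = 0).
Proof.
move=> PT at_ bt; rewrite ft// (box_cyl a b) !cylI at_.
have -> : `]t - eps, t[ `&` `]t, b 0 ord0[ = set0.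
  by apply/seteqP; split=> // x [] /=; rewrite !in_itv/=; lra.
have -> : `]t, t + eps[ `&` `]t, b 0 ord0[ = `]t, t + eps[%classic.
  by apply/seteqP; split=> x /=; rewrite !in_itv/=; lra.
rewrite cyl0 vol0 subr0; split=> [/setIidPl ->|->].
  rewrite vol_cyl ?lerDl ?(ltW e0)// addrAC subrr add0r.
  by rewrite divff// gt_eqF.
by rewrite vol_cyl ?lerDl ?(ltW e0)// vol0 mulr0 mul0r.
Qed.

End jump_estimates.

Context (X : normedModType R) (e : symmetric_basis X).

Lemma L1_integral0 T : parallelepipeds Omega T -> L1_integral T (0 : L1 oOmega) = 0.
Proof. by move=> PT; rewrite -(scale0r 0) (L1_integralZ PT) mul0r. Qed.

Lemma L1_integral_sum T N (c : 'I_N -> R) (f : 'I_N -> L1 oOmega) :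
  parallelepipeds Omega T ->
  L1_integral T (\sum_(i < N) c i *: f i) = \sum_(i < N) c i * L1_integral T (f i).
Proof.
move=> PT; rewrite (big_morph (L1_integral T) (L1_integralD PT) (L1_integral0 PT)).
by apply: eq_bigr => i _; rewrite (L1_integralZ PT).
Qed.

(** Apply [basis_block]. Each of the two faces of a box lies within [eps] of at most one [t i], and
    one jump integrates to at most 2, whence the sup bound 4; each jump has l^1 sum at most 2,
    whence [2 * N]. *)
Lemma JF_norm_jumps (N k : nat) (t c : 'I_N -> R) (eps : R) (f : 'I_N -> L1 oOmega) :
  (0 < k)%N -> 0 < eps -> (forall i, jump_fun (t i) eps (f i)) ->
  (forall i, `|c i| <= 1) -> (forall i j, i != j -> 2 * eps <= `|t i - t j|) ->
  JF_norm e (\sum_(i < N) c i *: f i) <= fundamental_fun e k * (4 + 2 * N%:R / k%:R).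
Proof.
move=> k0 e0 ft c1 tsep; apply: ge_sup; first by case: (JF_sums_has_sup e (\sum_(i < N) c i *: f i)).
move=> _ [m [T [PT tT ->]]]; under eq_bigr do rewrite L1_integral_sum//.
have v_le j : `|\sum_(i < N) c i * L1_integral (T j) (f i)| <=
    \sum_(i < N) `|L1_integral (T j) (f i)|.
  apply: le_trans (ler_norm_sum _ _ _) _; apply: ler_sum => i _.
  by rewrite normrM ler_piMl.
have f2 j i : `|L1_integral (T j) (f i)| <= 2.
  have := @jump_fun_sum_le (t i) eps (f i) e0 (ft i) 1 (fun=> T j) (fun=> PT j) _.
  rewrite big_ord1; apply; apply/trivIsetP => a b _ _.
  by rewrite (ord1 a) (ord1 b) eqxx.
apply: le_trans (basis_block e (k := k) (c := 4) _ _ _) _ => //.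
  move=> j; apply: le_trans (v_le j) _; have [a [b [ab TE _]]] := PT j.
  have close1 (z : R) : \sum_(i < N) (`|z - t i| < eps)%R%:R <= 1 :> R.
    apply: sum_indic_unique => i i' ti ti'; apply: contrapT => /eqP ii'.
    have := tsep _ _ ii'; rewrite leNgt => /negP; apply.
    have -> : t i - t i' = (z - t i') - (z - t i) by ring.
    apply: le_lt_trans (ler_normB _ _) _; rewrite (_ : 2 * eps = eps + eps); last by ring.
    exact: ltrD.
  apply: (@le_trans _ _ (\sum_(i < N) (2 * (`|a 0 ord0 - t i| < eps)%R%:R +
      2 * (`|b 0 ord0 - t i| < eps)%R%:R))).
    apply: ler_sum => i _; have := f2 j i.
    case: ltP => ai; case: ltP => bi; rewrite ?mulr1 ?mulr0 ?addr0 ?add0r//.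
      by move=> /le_trans; apply; rewrite lerDl.
    by move: (PT j); rewrite TE => PTj _; rewrite (jump_fun_local e0 (ft i) ab PTj ai bi) normr0.
  rewrite big_split/= -!mulr_sumr.
  have := close1 (a 0 ord0); have := close1 (b 0 ord0); lra.
rewrite ler_wpM2l ?fundamental_fun_ge0// lerD2l ler_wpM2r//.
apply: le_trans (ler_sum _ (fun j _ => v_le j)) _; rewrite exchange_big/=.
apply: le_trans (ler_sum _ (fun i _ => jump_fun_sum_le e0 (ft i) PT tT)) _.
by rewrite sumr_const card_ord mulr_natr.
Qed.

End jumps.

(** * Limit jumps and their vanishing on a separable set *)

Section jump_functionals.
Context (R : realType) (n : nat) (Omega : set 'rV[R]_n.+2) (oOmega : open Omega).
Context (X : normedModType R) (e : symmetric_basis X) (rX : reflexive_space X).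
Context (ka kb : 'rV[R]_n.+1) (kab : forall i, ka 0 i < kb 0 i).
Context (eps : nat -> R) (eps0 : forall m, 0 < eps m) (eps_cvg : eps m @[m --> \oo] --> 0).
Context (f : R -> nat -> L1 oOmega) (fP : forall t m, jump_fun ka kb t (eps m) (f t m)).
Context (L : (nat -> R) -> R) (bL : banach_limit L).
Local Notation JFX := (JF oOmega e).
Local Notation inj := (completion_inj (JF_seminorm oOmega e)).

(** One jump and block length 1: here 4 + 2 * 1 / 1 = 6. *)
Lemma jump_fun_norm t m : `|inj (f t m) : JFX| <= 6 * fundamental_fun e 1.
Proof.
rewrite completion_inj_norm.
have := @JF_norm_jumps _ _ _ oOmega ka kb kab X e 1 1 (fun=> t) (fun=> 1) (eps m) (fun=> f t m).
rewrite big_ord1 scale1r => h; apply: le_trans (h _ _ _ _ _) _ => //.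
- by move=> i; rewrite normr1.
- by move=> i j; rewrite (ord1 i) (ord1 j) eqxx.
rewrite divr1 mulr1 mulrC ler_wpM2r ?fundamental_fun_ge0//; clear h; lra.
Qed.

Context (G : R -> dual (dual JFX)).
Context (GE : forall t (y : dual JFX), G t y = L (fun m => y (inj (f t m)))).

(** If N points had jumps of size at least [delta], the sum of these jumps with matching signs would
    be at least N * delta, yet [JF_norm_jumps] bounds it by |y| F(k) (4 + 2N/k). *)
Lemma jump_functional_finite (y : dual JFX) (delta : R) : 0 < delta ->
  finite_set [set t | delta <= `|G t y|].
Proof.
have arith (A S M U : R) : 2 * A < M -> M <= S -> U <= M / 4 -> S <= A + 2 * U -> False.
  by lra.
move=> d0; apply: contrapT => infA.
have y1 : 0 < `|y| + 1 by rewrite ltr_wpDl.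
(* First k makes the part proportional to N at most N * delta / 2; then N makes the constant part 4
   |y| F(k) smaller than N * delta / 2. *)
have [k k0 Fk] := fundamental_fun_small (eta := delta / (4 * (`|y| + 1))) e rX
  ltac:(by rewrite divr_gt0// mulr_gt0).
set Fv := fundamental_fun e k in Fk.
have Fv0 : 0 <= Fv by exact: fundamental_fun_ge0.
have kR : 0 < k%:R :> R by rewrite ltr0n.
pose N := Num.bound (8 * `|y| * Fv / delta).
have HN : 8 * `|y| * Fv < N%:R * delta.
  by rewrite -ltr_pdivrMr// archi_boundP// divr_ge0 ?mulr_ge0// ltW.
have [B BA NB] := infinite_set_fset N infA.
pose t (i : 'I_N) := nth 0 (finmap.enum_fset B) i.
have tB i : (i < N)%N -> (i < size (finmap.enum_fset B))%N by move=> /leq_trans; apply.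
have tA i : delta <= `|G (t i) y|.
  by apply: BA; rewrite /= /t mem_nth// tB.
have tneq i j : i != j -> t i != t j.
  by apply: contraNneq => /eqP; rewrite nth_uniq ?finmap.fset_uniq ?tB.
pose c i := Num.sg (G (t i) y).
have c1 i : `|c i| <= 1 by rewrite normr_sg; case: (_ != _).
have bu i : bounded_seq (fun m => y (inj (f (t i) m))).
  exists (`|y| * (6 * fundamental_fun e 1)) => m.
  by apply: le_trans (dual_norm_mul y _) _; rewrite ler_wpM2l// jump_fun_norm.
have [bS LS] := banach_limit_sum (index_enum 'I_N) c bL bu.
have lowS : N%:R * delta <= \sum_i c i * G (t i) y.
  rewrite mulr_natl -[X in _ *+ X]card_ord -sumr_const.
  by apply: ler_sum => i _; rewrite /c -normrEsg.
have : \sum_i c i * G (t i) y <= `|y| * (Fv * (4 + 2 * N%:R / k%:R)).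
  rewrite (eq_bigr _ (fun i _ => congr1 (fun x => c i * x) (GE (t i) y))) -LS.
  apply: (banach_limit_le bL) => //.
  (* The finitely many points are distinct, so they are eventually separated by [2 * eps m]. *)
  have : \forall m \near \oo, forall ij : 'I_N * 'I_N,
      ij.1 != ij.2 -> 2 * eps m <= `|t ij.1 - t ij.2|.
    apply: filter_forall => -[i j] /=; have [->|ij] := eqVneq i j.
      by apply: nearW.
    have tij : 0 < `|t i - t j| / 2 by rewrite divr_gt0// normr_gt0 subr_eq0 tneq.
    apply: filterS (cvgr0_norm_lt _ eps_cvg _ tij) => m em _.
    by rewrite mulrC -ler_pdivlMr// ltW// (le_lt_trans (ler_norm _)).
  apply: filterS => m sep.
  have -> : \sum_i c i * y (inj (f (t i) m)) = y (inj (\sum_i c i *: f (t i) m)).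
    rewrite completion_inj_sum linear_sum.
    by apply: eq_bigr => i _; rewrite linearZ.
  apply: le_trans (ler_norm _) _; apply: le_trans (dual_norm_mul _ _) _.
  rewrite ler_wpM2l// completion_inj_norm.
  apply: (@JF_norm_jumps _ _ _ oOmega ka kb kab X e N k t c (eps m)) => // i j ij.
  exact: (sep (i, j)).
have kk : Fv / k%:R <= delta / (4 * (`|y| + 1)) by rewrite ler_pdivrMr.
have yk : `|y| * (Fv / k%:R) <= delta / 4.
  apply: le_trans (ler_wpM2l (normr_ge0 y) kk) _.
  rewrite mulrA ler_pdivrMr ?mulr_gt0//.
  rewrite (_ : delta / 4 * _ = (`|y| + 1) * delta); last by field.
  by rewrite ler_wpM2r ?(ltW d0)// lerDl.
have N0 : 0 <= N%:R :> R by rewrite ler0n.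
have NU : N%:R * (`|y| * (Fv / k%:R)) <= N%:R * delta / 4.
  by rewrite -mulrA ler_wpM2l.
rewrite (_ : `|y| * (Fv * (4 + 2 * N%:R / k%:R)) =
   4 * `|y| * Fv + 2 * (N%:R * (`|y| * (Fv / k%:R)))); last by ring.
apply: arith lowS NU; apply: le_lt_trans HN.
by rewrite !mulrA -natrM.
Qed.

End jump_functionals.

(** The bad t form a countable union of finite sets, over k, a countable dense set and thresholds
    1/(j+1), while an interval has positive measure. Continuity passes from the dense set to [A]. *)
Lemma separable_vanish (R : realType) (V : normedModType R) (A : set V)
    (G : R * nat -> dual V) (a b : R) : a < b -> separable_set A ->
  (forall k y (delta : R), 0 < delta -> finite_set [set t | delta <= `|G (t, k) y|]) ->
  exists2 t, a < t < b & forall k y, A y -> G (t, k) y = 0.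
Proof.
move=> ab [D [cD DA AD]] Gfin.
pose bad := \bigcup_(k in [set: nat]) \bigcup_(y in D) \bigcup_(j in [set: nat])
  [set t | (j.+1%:R^-1 : R) <= `|G (t, k) y|].
have cbad : countable bad.
  apply: bigcup_countable => // k _; apply: bigcup_countable => // y _.
  apply: bigcup_countable => // j _; apply: finite_set_countable.
  by apply: Gfin; rewrite invr_gt0 ltr0n.
have [t [tab nbad]] : exists t, a < t < b /\ ~ bad t.
  apply: contrapT => nt.
  have sub : `]a, b[%classic `<=` bad.
    move=> t; rewrite /= in_itv/= => tab; apply: contrapT => nb.
    by apply: nt; exists t.
  have := countable_lebesgue_measure0 (sub_countable (subset_card_le sub) cbad).
  rewrite lebesgue_measure_itv/= lte_fin ab -EFinD => -[] /eqP.
  by rewrite subr_eq0 => /eqP ba; rewrite ba ltxx in ab.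
exists t => // k y Ay.
have GD z : D z -> G (t, k) z = 0.
  move=> Dz; apply/eqP; apply: contrapT => /negP Gz; apply: nbad.
  have Gz0 : 0 < `|G (t, k) z| by rewrite normr_gt0.
  have [j _ jP] := near_infty_natSinv_lt (PosNum Gz0).
  exists k => //; exists z => //; exists j => //=.
  by apply: ltW; exact: (jP j (leqnn j)).
have cl : closed [set z | G (t, k) z = 0].
  have := @preimage_closed _ _ (G (t, k)) [set 0] (fun z _ => @dual_continuous _ _ (G (t, k)) z).
  by apply; exact: closed_eq.
exact: (cl y (closureS GD (AD y Ay))).
Qed.

(** * Choice of the boxes and conclusion *)

Theorem propositionC (R : realType) (X : completeNormedModType R)
    (e : symmetric_basis X) (d0 : nat) (Omega : set 'rV[R]_d0)
    (oOmega : open Omega) :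
  reflexive_space X -> (1 < d0)%N -> bounded_set Omega -> Omega !=set0 ->
  forall Y : closed_subspace (dual (JF oOmega e)),
    separable_set [set` Y] -> ~ reflexive_space (quotient_space Y).
Proof.
case: d0 Omega oOmega => [|[|n]]// Omega oOmega rX _ _ [x0 Ox0] Y sepY.
have /nbhs_ballP[rho /= rho0 xO] : nbhs x0 Omega by exact: open_nbhs_nbhs.
(* With t in the interval of length h before the centre, both t and t + h stay within [rho] of
   it. *)
pose h := rho / 2; have h0 : 0 < h by rewrite divr_gt0.
have boxO (a b : 'rV[R]_n.+2) :
    (forall i, x0 0 i - rho <= a 0 i) -> (forall i, b 0 i <= x0 0 i + rho) ->
    box a b `<=` Omega.
  move=> xa bx x xab; apply: xO; split=> // i j; rewrite ord1 /ball/= ltr_distl.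
  have /andP[ax xb] := xab j; apply/andP; split.
    by rewrite ltrBlDr (lt_le_trans xb).
  by rewrite -ltrBlDr (le_lt_trans (xa j)).
pose x1 := tail x0.
(* Strictly increasing levels on the second axis, which exists as the dimension is at least 2; they
   start at the centre and stay within [rho]. *)
pose s k : R := x1 0 ord0 + rho * (1 - k.+1%:R^-1).
have s_lt k l : (k < l)%N -> s k < s l.
  move=> kl; rewrite ltrD2l ltr_pM2l// ltrD2l ltrN2 ltf_pV2 ?posrE ?ltr0n//.
  by rewrite ltr_nat ltnS.
have s_le k l : (k <= l)%N -> s k <= s l.
  by rewrite leq_eqVlt => /predU1P[->//|/s_lt/ltW].
have s0 : s 0%N = x1 0 ord0 by rewrite /s invr1 subrr mulr0 addr0.
have s_ub k : s k <= x1 0 ord0 + rho.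
  by rewrite lerD2l ler_piMr ?(ltW rho0)// gerBl invr_ge0 ler0n.
(* Corners in the remaining axes: index [ord0] is the second axis of the space, the others have
   fixed sides of length [rho]. *)
pose low (z : R) : 'rV[R]_n.+1 := \row_i (if i == ord0 then z else x1 0 i).
pose upp (z : R) : 'rV[R]_n.+1 := \row_i (if i == ord0 then z else x1 0 i + rho).
have lowupp c d : c < d -> forall i, low c 0 i < upp d 0 i.
  by move=> cd i; rewrite !mxE; case: ifP => // _; rewrite ltrDl.
pose eps (m : nat) : R := h * m.+1%:R^-1.
have eps0 m : 0 < eps m by rewrite mulr_gt0// invr_gt0 ltr0n.
have eps_le m : eps m <= h.
  by rewrite ler_piMr ?(ltW h0)// invf_le1 ?ltr0n// ler1n.
have eps_cvg : eps m @[m --> \oo] --> 0.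
  by rewrite -(mulr0 h); apply: cvgMl_tmp; exact: cvg_harmonic.
have kab k := lowupp _ _ (s_lt k k.+1 (ltnSn k)).
have /choice[f fP] : forall q : R * nat * nat, exists g : L1 oOmega,
    jump_fun (low (s q.1.2)) (upp (s q.1.2.+1)) q.1.1 (eps q.2) g.
  by move=> q; exact: jump_fun_exists (kab _) _ _.
pose inj := completion_inj (JF_seminorm oOmega e).
have [L bL] := banach_limit_exists R.
have zC q m : `|inj (f (q, m))| <= 6 * fundamental_fun e 1.
  case: q => t k.
  exact: (@jump_fun_norm _ _ _ oOmega _ e _ _ (kab k) eps eps0
    (fun t m => f (t, k, m)) (fun t m => fP (t, k, m)) t m).
have /choice[G GE] : forall q : R * nat, exists g : dual (dual (JF oOmega e)),
    forall y, g y = L (fun m => y (inj (f (q, m)))).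
  by move=> q; exact: bidual_limit bL (zC q).
have [t /andP[t1 t2] Gt] : exists2 t, x0 0 ord0 - h < t < x0 0 ord0 &
    forall k y, [set` Y] y -> G (t, k) y = 0.
  apply: separable_vanish => //; first by rewrite gtrBl.
  move=> k y delta; exact: (@jump_functional_finite _ _ _ oOmega _ e rX _ _ (kab k)
    eps eps0 eps_cvg (fun t m => f (t, k, m)) (fun t m => fP (t, k, m)) L bL
    (fun t => G (t, k)) (fun t => GE (t, k))).
(* The cross-section of [T j] runs from level [s 0] to [s j.+1]: it contains the pieces K_k with k
   <= j and misses the later ones. *)
pose T j := box (row_cons (t, low (s 0%N))) (row_cons (t + h, upp (s j.+1))).
have tailE (c : R) (v : 'rV[R]_n.+1) : tail (row_cons (c, v)) = v.
  by apply/rowP => i; rewrite mxE row_consES.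
have PT j : parallelepipeds Omega (T j).
  exists (row_cons (t, low (s 0%N))), (row_cons (t + h, upp (s j.+1))).
  split=> //.
    move=> i; have [l ->|->] := unliftP ord0 i; last by rewrite !row_consE0 /= ltrDl.
    by rewrite !row_consES /=; apply: lowupp; exact: s_lt.
  apply: boxO => i; have [l ->|->] := unliftP ord0 i.
  - rewrite row_consES /= s0 mxE; case: eqP => [->|_]; rewrite mxE gerBl ltW//.
  - rewrite row_consE0 /=; move: t1; rewrite /h; lra.
  - rewrite row_consES /= mxE; case: eqP => [->|_]; last by rewrite mxE.
    by apply: le_trans (s_ub _) _; rewrite mxE.
  - rewrite row_consE0 /=; move: t2; rewrite /h; lra.
have e0 : 0 < `|e 0%N| by rewrite normr_gt0 basis_neq0.
(* A single box is a one-term family in [JF_sums], which gives the bound by the inverse of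
   [|e 0|]. *)
have /choice[phi phiP] : forall j, exists g : dual (JF oOmega e),
    (forall x, `|g x| <= `|e 0%N|^-1 * `|x|) /\
    forall u, g (inj u) = L1_integral (T j) u.
  move=> j; apply: completion_extend => [a u v|u].
    by rewrite (L1_integralD (PT j)) (L1_integralZ (PT j)).
  rewrite ler_pdivlMl// mulrC; apply: sup_upper_bound; first exact: JF_sums_has_sup.
  exists 1%N, (fun=> T j); split=> //.
    by apply/trivIsetP => a b _ _; rewrite (ord1 a) (ord1 b) eqxx.
  by rewrite big_ord1 normrZ.
apply: (@quotient_not_reflexive _ _ Y phi (fun k => G (t, k)) `|e 0%N|^-1
  (6 * fundamental_fun e 1)).
- move=> j; apply: dual_norm_bound; last by rewrite invr_ge0 ltW.
  by have [] := phiP j.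
- move=> k; apply: dual_norm_bound; last by rewrite mulr_ge0// fundamental_fun_ge0.
  move=> y; rewrite GE; apply: (banach_limit_norm bL) => m.
  by apply: le_trans (dual_norm_mul _ _) _; rewrite mulrC ler_wpM2r.
- by move=> k y yY; exact: Gt.
move=> k j; rewrite GE; apply: (banach_limit_eq bL); apply: nearW => m.
have [_ ->] := phiP j.
(* Since [eps m <= h], the right slab fits in [T j] along the first axis for every m, so the values
   are constant in m. *)
have te : t + eps m <= (row_cons (t + h, upp (s j.+1)) : 'rV[R]_n.+2) 0 ord0.
  by rewrite row_consE0 lerD2l.
have [val1 val0] := jump_fun_value (kab k) (eps0 m) (fP (t, k, m)) (PT j)
  (row_consE0 _) te.
have [kj|jk] := leqP k j.
  apply: val1; rewrite !tailE => x xk i; have := xk i; rewrite !mxE.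
  case: ifP => // _ /andP[h1 h2]; apply/andP; split.
    exact: le_lt_trans (s_le _ _ _) h1.
  exact: lt_le_trans h2 (s_le _ _ _).
apply: val0; rewrite !tailE; apply/seteqP; split=> // x [/(_ ord0) + /(_ ord0)].
rewrite !mxE eqxx => /andP[h1 _] /andP[_ h2].
have := s_le _ _ jk; rewrite leNgt => /negP; apply.
exact: lt_trans h1 h2.
Qed.
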